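(* Let $G,H,K$ be finite groups, $\Bbbk$ a commutative ring, and let $X\le G\times H$ and $Y\le H\times K$ be subgroups. The two functors $$(M,N)\mapsto M\overset{X,Y}{\otimes}N\qquad\text{and}\qquad(M,N)\mapsto\mathrm{DefRes}^{X\times Y}_{X*Y}\cdot_{X\times Y}(M\otimes_{\Bbbk}N),$$ from the product of the categories of left $\Bbbk X$-modules and left $\Bbbk Y$-modules to the category of left $\Bbbk[X*Y]$-modules, are naturally isomorphic.
   Context: **Bisets and tensor products.** For finite groups $G,H,K$, a $(G,H)$-biset is a finite set with commuting left $G$-action and right $H$-action. For a $(G,H)$-biset $U$ and an $(H,K)$-biset $V$, $U\otimes_HV$ is the set of $H$-orbits of $U\times V$ under $h\cdot(u,v)=(uh^{-1},hv)$, which is a $(G,K)$-biset via $g(u\otimes v)k=(gu)\otimes(vk)$, where $u\otimes v$ is the orbit of $(u,v)$. Elementary bisets: for $A\le B$, $\mathrm{Res}^B_A$ is the $(A,B)$-biset $B$ with left and right multiplication; for $N\trianglelefteq B$, $\mathrm{Def}^B_{B/N}$ is the $(B/N,B)$-biset $B/N$ with left multiplication and right multiplication via $B\to B/N$; for an isomorphism $\alpha\colon B\to B'$, $\mathrm{Iso}_\alpha$ is the $(B',B)$-biset $B'$ with left multiplication and right multiplication via $\alpha$. **Biset action on modules.** For a $(G,H)$-biset $U$ and a left $\Bbbk H$-module $M$, $U\cdot_HM:=\Bbbk U\otimes_{\Bbbk H}M$, a left $\Bbbk G$-module, where $\Bbbk U$ is the free $\Bbbk$-module on $U$. For a left $\Bbbk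 X$-module $M$ and a left $\Bbbk Y$-module $N$, $M\otimes_{\Bbbk}N$ is a left $\Bbbk[X\times Y]$-module via $(x,y)(m\otimes n)=xm\otimes yn$. **Subgroups of direct products.** For $X\le G\times H$, set $k_1(X)=\{g\in G\mid(g,1)\in X\}$, $k_2(X)=\{h\in H\mid(1,h)\in X\}$; similarly for $Y\le H\times K$. Set $X*Y=\{(g,k)\in G\times K\mid\exists h\in H:(g,h)\in X,\ (h,k)\in Y\}\le G\times K$, $k(X,Y)=k_2(X)\cap k_1(Y)\le H$, and $X\times_HY=\{((g,h),(\tilde h,k))\in X\times Y\mid h=\tilde h\}\le X\times Y$. **Extended tensor product.** Let $M$ be a left $\Bbbk X$-module and $N$ a left $\Bbbk Y$-module. By restriction, $M$ is a $(\Bbbk k_1(X),\Bbbk k(X,Y))$-bimodule via $g\cdot m\cdot h=(g,h^{-1})m$, and $N$ is a $(\Bbbk k(X,Y),\Bbbk k_2(Y))$-bimodule via $h\cdot n\cdot k=(h,k^{-1})n$. On $M\otimes_{\Bbbk k(X,Y)}N$ the group $X*Y$ acts by $(g,k)(m\otimes n)=(g,h)m\otimes(h,k)n$, where $h\in H$ is any element with $(g,h)\in X$ and $(h,k)\in Y$ (well defined, independent of $h$). The resulting left $\Bbbk[X*Y]$-module is $M\overset{X,Y}{\otimes}N$. **The biset $\mathrm{DefRes}$.** Let $\nu\colon X\times_HY\to X*Y$, $((g,h),(h,k))\mapsto(g,k)$, a surjective homomorphism, and $\bar\nu\colon(X\times_HY)/\ker(\nu)\to X*Y$ the induced isomorphism.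 Define the $(X*Y,X\times Y)$-biset $$\mathrm{DefRes}^{X\times Y}_{X*Y}:=\mathrm{Iso}_{\bar\nu}\otimes_{(X\times_HY)/\ker(\nu)}\mathrm{Def}^{X\times_HY}_{(X\times_HY)/\ker(\nu)}\otimes_{X\times_HY}\mathrm{Res}^{X\times Y}_{X\times_HY}.$$ *)

(* Defs.v *)
From HB Require Import structures.
From mathcomp Require Import all_boot all_order all_algebra all_fingroup.
From mathcomp Require Import boolp.
From mathcomp.multinomials Require Import freeg.

Set Implicit Arguments.
Unset Strict Implicit.
Unset Printing Implicit Defensive.

Import GRing.Theory.
Local Open Scope ring_scope.

Record category := Category {
  obj :> Type;
  chom : obj -> obj -> Type;
  idm : forall a, chom a a;
  ccomp : forall a b c, chom b c -> chom a b -> chom a c;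
  comp_idl : forall a b (f : chom a b), ccomp (idm b) f = f;
  comp_idr : forall a b (f : chom a b), ccomp f (idm a) = f;
  compA : forall a b c d (h : chom c d) (g : chom b c) (f : chom a b),
            ccomp h (ccomp g f) = ccomp (ccomp h g) f
}.
Arguments chom {_} _ _.
Arguments idm {_} _.
Arguments ccomp {_ _ _ _} _ _.

Record functor (C D : category) := Functor {
  fobj :> C -> D;
  fmap : forall a b, chom a b -> chom (fobj a) (fobj b);
  fmap_id : forall a, fmap (idm a) = idm (fobj a);
  fmap_comp : forall a b c (g : chom b c) (f : chom a b),
    fmap (ccomp g f) = ccomp (fmap g) (fmap f)
}.
Arguments fmap {_ _} _ {_ _} _.

Section FunctorComp.
Variables (C D E : category) (G : functor D E) (F : functor C D).

Lemma fcomp_id a : fmap G (fmap F (idm a)) = idm (G (F a)).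
Proof. by rewrite !fmap_id. Qed.

Lemma fcomp_comp a b c (g : chom b c) (f : chom a b) :
  fmap G (fmap F (ccomp g f)) = ccomp (fmap G (fmap F g)) (fmap G (fmap F f)).
Proof. by rewrite !fmap_comp. Qed.

Definition functor_comp : functor C E := Functor fcomp_id fcomp_comp.
End FunctorComp.

Section ProdCategory.
Variables C D : category.

Let hom2 (p q : C * D) : Type := (chom p.1 q.1 * chom p.2 q.2)%type.
Let idm2 p : hom2 p p := (idm p.1, idm p.2).
Let comp2 p q r (g : hom2 q r) (f : hom2 p q) : hom2 p r :=
  (ccomp g.1 f.1, ccomp g.2 f.2).

Let comp2_idl p q (f : hom2 p q) : comp2 (idm2 q) f = f.
Proof. by case: f => f1 f2; rewrite /comp2 !comp_idl. Qed.
Let comp2_idr p q (f : hom2 p q) : comp2 f (idm2 p) = f.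
Proof. by case: f => f1 f2; rewrite /comp2 !comp_idr. Qed.
Let comp2A p q r s (h : hom2 r s) (g : hom2 q r) (f : hom2 p q) :
  comp2 h (comp2 g f) = comp2 (comp2 h g) f.
Proof. by rewrite /comp2 !compA. Qed.

Definition prod_cat : category := Category comp2_idl comp2_idr comp2A.
End ProdCategory.

Definition is_iso (C : category) (a b : C) (f : chom a b) : Prop :=
  exists g : chom b a, ccomp g f = idm a /\ ccomp f g = idm b.

Definition natural (C D : category) (F G : functor C D)
    (eta : forall c, chom (F c) (G c)) : Prop :=
  forall a b (f : chom a b), ccomp (eta b) (fmap F f) = ccomp (fmap G f) (eta a).

Definition naturally_isomorphic (C D : category) (F G : functor C D) : Prop :=
  exists2 eta : forall c, chom (F c) (G c),
    natural eta & forall c, is_iso (eta c).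

Lemma linear_ext (R : pzRingType) (M N : lmodType R) (f g : {linear M -> N}) :
  f =1 g -> f = g.
Proof.
case: f g => [f [[fD] [fZ]]] [g [[gD] [gZ]]] /= /funext fg.
case: _ / fg in gD gZ *.
by rewrite (Prop_irrelevance fD gD) (Prop_irrelevance fZ gZ).
Qed.

Section ModCategory.
Variable R : pzRingType.
Implicit Types M N : lmodType R.

Let mod_hom M N : Type := {linear M -> N}.
Let mod_id M : mod_hom M M := idfun.
Let mod_comp L M N (g : mod_hom M N) (f : mod_hom L M) : mod_hom L N := g \o f.

Let mod_comp_idl M N (f : mod_hom M N) : mod_comp (mod_id N) f = f.
Proof. exact: linear_ext. Qed.
Let mod_comp_idr M N (f : mod_hom M N) : mod_comp f (mod_id M) = f.
Proof. exact: linear_ext. Qed.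
Let mod_compA K L M N (h : mod_hom M N) (g : mod_hom L M) (f : mod_hom K L) :
  mod_comp h (mod_comp g f) = mod_comp (mod_comp h g) f.
Proof. exact: linear_ext. Qed.

Definition mod_cat : category :=
  @Category (lmodType R) mod_hom mod_id mod_comp
    mod_comp_idl mod_comp_idr mod_compA.
End ModCategory.

Definition restr (R S : pzRingType) (f : {rmorphism R -> S}) (M : lmodType S)
  : Type := M.

Section Restriction.
Variables (R S : pzRingType) (f : {rmorphism R -> S}).

HB.instance Definition _ (M : lmodType S) := GRing.Zmodule.on (restr f M).

Section Module.
Variable M : lmodType S.
Let scale (r : R) (m : restr f M) : restr f M := f r *: (m : M).
Let scaleA a b m : scale a (scale b m) = scale (a * b) m.
Proof. by rewrite /scale rmorphM scalerA. Qed.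
Let scale1 : left_id 1 scale.
Proof. by move=> m; rewrite /scale rmorph1 scale1r. Qed.
Let scaleDr : right_distributive scale +%R.
Proof. by move=> a m n; rewrite /scale scalerDr. Qed.
Let scaleDl m : {morph scale^~ m : a b / a + b}.
Proof. by move=> a b; rewrite /scale rmorphD scalerDl. Qed.
HB.instance Definition _ :=
  GRing.Zmodule_isLmodule.Build R (restr f M) scaleA scale1 scaleDr scaleDl.
End Module.

Lemma restrZ (M : lmodType S) (r : R) (m : restr f M) :
  r *: m = f r *: (m : M).
Proof. by []. Qed.

End Restriction.

(* R need not be commutative; a right R-module is a left R^c-module.  The tensor
   product is the free abelian group on A * B modulo the subgroup tensor_rel. *)

Section Tensor.
Variables (R : pzRingType) (A : lmodType R^c) (B : lmodType R).

Local Notation F := {freeg (A * B) / int}.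

Inductive tensor_rel : F -> Prop :=
| TensorDl a a' b :
    tensor_rel (<<(a + a', b)>> - (<<(a, b)>> + <<(a', b)>>))
| TensorDr a b b' :
    tensor_rel (<<(a, b + b')>> - (<<(a, b)>> + <<(a, b')>>))
| TensorZ a (r : R) b :
    tensor_rel (<<((r : R^c) *: a, b)>> - <<(a, r *: b)>>)
| Tensor0 : tensor_rel 0
| TensorB x y : tensor_rel x -> tensor_rel y -> tensor_rel (x - y).

Definition tensor_relb : {pred F} := fun x => `[< tensor_rel x >].

Lemma tensor_relP x : reflect (tensor_rel x) (x \in tensor_relb).
Proof. exact: asboolP. Qed.

Lemma tensor_rel_zmod_closed : zmod_closed tensor_relb.
Proof.
split=> [|x y /tensor_relP xI /tensor_relP yI]; apply/tensor_relP.
  exact: Tensor0.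
exact: TensorB.
Qed.

HB.instance Definition _ :=
  GRing.isZmodClosed.Build F tensor_relb tensor_rel_zmod_closed.

Definition tensor : Type := Quotient.quot tensor_relb.
HB.instance Definition _ := GRing.Zmodule.on tensor.

Definition tens (a : A) (b : B) : tensor :=
  \pi_(Quotient.quot tensor_relb)%qT <<(a, b)>>.

Lemma tensDl a a' b : tens (a + a') b = tens a b + tens a' b.
Proof.
rewrite /tens -[RHS]raddfD; apply/eqP; rewrite -Quotient.idealrBE.
exact/tensor_relP/TensorDl.
Qed.

Lemma tensDr a b b' : tens a (b + b') = tens a b + tens a b'.
Proof.
rewrite /tens -[RHS]raddfD; apply/eqP; rewrite -Quotient.idealrBE.
exact/tensor_relP/TensorDr.
Qed.

Lemma tensZ a (r : R) b : tens ((r : R^c) *: a) b = tens a (r *: b).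
Proof.
by apply/eqP; rewrite -Quotient.idealrBE; apply/tensor_relP/TensorZ.
Qed.

Section Lift.
Variable Z : zmodType.

Definition balanced (beta : A -> B -> Z) : Prop :=
  [/\ forall a a' b, beta (a + a') b = beta a b + beta a' b,
      forall a b b', beta a (b + b') = beta a b + beta a b'
    & forall a (r : R) b, beta ((r : R^c) *: a) b = beta a (r *: b)].

Variables (beta : A -> B -> Z) (betaP : balanced beta).

Let lift0 (x : F) : zmodule Z := fglift (fun p => beta p.1 p.2 : zmodule Z) x.

Let lift0B x y : lift0 (x - y) = lift0 x - lift0 y.
Proof. exact: lift_is_additive. Qed.

Let lift0_rel x : tensor_rel x -> lift0 x = 0.
Proof.
have lift0D u v : lift0 (u + v) = lift0 u + lift0 v.
  have lift0N w : lift0 (- w) = - lift0 w.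
    by rewrite -[- w]sub0r lift0B -[X in lift0 X](subrr w) lift0B subrr sub0r.
  by rewrite -{1}[v]opprK lift0B lift0N opprK.
case: betaP => bDl bDr bZ.
elim=> {x} [a a' b|a b b'|a r b||x y _ hx _ hy].
- by rewrite lift0B lift0D /lift0 !liftU /= !scale1r bDl subrr.
- by rewrite lift0B lift0D /lift0 !liftU /= !scale1r bDr subrr.
- by rewrite lift0B /lift0 !liftU /= !scale1r bZ subrr.
- by rewrite -[X in lift0 X](subrr 0) lift0B subrr.
- by rewrite lift0B hx hy subrr.
Qed.

Definition tlift of balanced beta := fun t : tensor =>
  lift0 (generic_quotient.repr (t : Quotient.quot tensor_relb)) : Z.

Let tlift_pi x : tlift betaP (\pi_(Quotient.quot tensor_relb)%qT x) = lift0 x.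
Proof.
apply/eqP; rewrite -subr_eq0 -[X in X == _]lift0B; apply/eqP/lift0_rel.
by apply/tensor_relP; rewrite Quotient.idealrBE reprK.
Qed.

Lemma tlift_is_zmod_morphism : zmod_morphism (tlift betaP).
Proof.
move=> x y; rewrite -[x](@reprK _ (Quotient.quot tensor_relb)).
rewrite -[y](@reprK _ (Quotient.quot tensor_relb)).
by rewrite -raddfB !tlift_pi lift0B.
Qed.
HB.instance Definition _ :=
  GRing.isZmodMorphism.Build tensor Z (tlift betaP) tlift_is_zmod_morphism.

Lemma tliftE a b : tlift betaP (tens a b) = beta a b.
Proof. by rewrite /tens tlift_pi /lift0 liftU scale1r. Qed.

End Lift.

Lemma tensor_ext (Z : zmodType) (f g : {additive tensor -> Z}) :
  (forall a b, f (tens a b) = g (tens a b)) -> f =1 g.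
Proof.
move=> fg t; rewrite -[t](@reprK _ (Quotient.quot tensor_relb)).
set x := generic_quotient.repr _; rewrite -[x]freeg_sumE !raddf_sum; apply: eq_bigr => -[a b] _.
by rewrite -[coeff _ _]intz -freegU_mulz !raddfMz -/(tens a b) fg.
Qed.
End Tensor.

Section TensorMap.
Variables (R : pzRingType) (A A' : lmodType R^c) (B B' : lmodType R).
Variables (f : {linear A -> A'}) (g : {linear B -> B'}).

Let beta a b := tens (f a) (g b).

Let beta_balanced : balanced beta.
Proof.
rewrite /beta; split=> [a a' b|a b b'|a r b].
- by rewrite linearD tensDl.
- by rewrite linearD tensDr.
- by rewrite !linearZ /= tensZ.
Qed.

Definition tmap : tensor A B -> tensor A' B' := tlift beta_balanced.
HB.instance Definition _ := GRing.Additive.on tmap.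

Lemma tmapE a b : tmap (tens a b) = tens (f a) (g b).
Proof. exact: tliftE. Qed.

End TensorMap.

(* R is a k-algebra through i, whose image is central.  mathcomp's algType
   would force R, hence k, to be nontrivial. *)

Section KTensor.
Variables (k : comPzRingType) (R : pzRingType) (i : {rmorphism k -> R}).

Definition central := forall c r, i c * r = r * i c.

Definition ktensor of central := @tensor R.

Variables (iC : central) (A : lmodType R^c) (B : lmodType R).

HB.instance Definition _ := GRing.Zmodule.on (ktensor iC A B).

Let beta c (a : A) (b : B) := tens ((i c : R^c) *: a) b.

Let beta_balanced c : balanced (beta c).
Proof.
rewrite /beta; split=> [a a' b|a b b'|a r b].
- by rewrite scalerDr tensDl.
- by rewrite tensDr.
- rewrite -tensZ !scalerA; congr (tens (_ *: _) _).
  exact: esym (iC c r).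
Qed.

Let scale c : ktensor iC A B -> ktensor iC A B := tlift (beta_balanced c).
HB.instance Definition _ c := GRing.Additive.on (scale c).

Let scaleE c a b : scale c (tens a b) = tens ((i c : R^c) *: a) b.
Proof. exact: tliftE. Qed.

Let scaleA c d t : scale c (scale d t) = scale (c * d) t.
Proof.
apply: (@tensor_ext _ _ _ _ (scale c \o scale d) (scale (c * d))) => a b /=.
rewrite !scaleE scalerA; congr (tens (_ *: _) _).
by rewrite [c * d]mulrC rmorphM.
Qed.

Let scale1 : left_id 1 scale.
Proof.
apply: (@tensor_ext _ _ _ _ (scale 1) idfun) => a b /=.
by rewrite scaleE rmorph1 scale1r.
Qed.

Let scaleDr : right_distributive scale +%R.
Proof. by move=> c t u; rewrite raddfD. Qed.

Let scaleDl t : {morph scale^~ t : c d / c + d}.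
Proof.
move=> c d; apply: (@tensor_ext _ _ _ _ (scale (c + d)) (scale c \+ scale d)).
by move=> a b /=; rewrite !scaleE rmorphD scalerDl tensDl.
Qed.

HB.instance Definition _ := GRing.Zmodule_isLmodule.Build k (ktensor iC A B)
  scaleA scale1 scaleDr scaleDl.

Lemma ktensorZ c a b :
  c *: (tens a b : ktensor iC A B) = tens ((i c : R^c) *: a) b.
Proof. exact: scaleE. Qed.

End KTensor.

(* The product is convolution, not the pointwise product of {ffun gT -> k}. *)
Definition galg (k : comPzRingType) (gT : finGroupType) : Type :=
  {ffun gT -> k^o}.

Section GroupAlgebra.
Variables (k : comPzRingType) (gT : finGroupType).

HB.instance Definition _ := GRing.Lmodule.on (galg k gT).

Definition gcoef (a : galg k gT) (x : gT) : k := (a : {ffun gT -> k^o}) x.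
Definition gelt (x : gT) : galg k gT := [ffun y => (y == x)%:R].

Let mul (a b : galg k gT) : galg k gT :=
  [ffun z => \sum_y gcoef a y * gcoef b (y^-1 * z)%g].

Let mulA : associative mul.
Proof.
move=> a b c; apply/ffunP=> z; rewrite !ffunE /gcoef.
under eq_bigr => y _ do rewrite ffunE big_distrr /=.
under [RHS]eq_bigr => y _ do rewrite ffunE big_distrl /=.
rewrite [RHS]exchange_big /=; apply: eq_bigr => y _.
rewrite (reindex_inj (mulgI y^-1%g)) /=; apply: eq_bigr => x _.
by rewrite mulrA invMg invgK mulgA mulgK.
Qed.

Let mul1 : left_id (gelt 1%g) mul.
Proof.
move=> a; apply/ffunP=> z; rewrite !ffunE /gcoef (bigD1 1%g) //= ffunE eqxx.
rewrite mul1r invg1 mul1g big1 ?addr0 // => y /negPf y1.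
by rewrite ffunE y1 mul0r.
Qed.

Let mulx1 : right_id (gelt 1%g) mul.
Proof.
move=> a; apply/ffunP=> z; rewrite !ffunE /gcoef (bigD1 z) //= ffunE mulVg eqxx.
rewrite mulr1 big1 ?addr0 // => y yz.
by rewrite ffunE -eq_mulVg1 (negPf yz) mulr0.
Qed.

Let mulDl : left_distributive mul +%R.
Proof.
move=> a b c; apply/ffunP=> z; rewrite !ffunE /gcoef -big_split /=.
by apply: eq_bigr => y _; rewrite ffunE mulrDl.
Qed.

Let mulDr : right_distributive mul +%R.
Proof.
move=> a b c; apply/ffunP=> z; rewrite !ffunE /gcoef -big_split /=.
by apply: eq_bigr => y _; rewrite ffunE mulrDr.
Qed.

HB.instance Definition _ :=
  GRing.Zmodule_isPzRing.Build (galg k gT) mulA mul1 mulx1 mulDl mulDr.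

Lemma galg_eqP a b : gcoef a =1 gcoef b -> a = b.
Proof. by move=> ab; apply/ffunP. Qed.

Lemma gcoefD a b x : gcoef (a + b) x = gcoef a x + gcoef b x.
Proof. by rewrite /gcoef ffunE. Qed.

Lemma gcoefZ c a x : gcoef (c *: a) x = c * gcoef a x.
Proof. by rewrite /gcoef ffunE. Qed.

Lemma gcoefM a b z :
  gcoef (a * b) z = \sum_y gcoef a y * gcoef b (y^-1 * z)%g.
Proof. by rewrite /gcoef [in LHS]ffunE. Qed.

Lemma gcoef_elt x y : gcoef (gelt x) y = (y == x)%:R.
Proof. by rewrite /gcoef ffunE. Qed.

Lemma gelt1 : gelt 1%g = 1.
Proof. by []. Qed.

Lemma geltM x y : gelt (x * y)%g = gelt x * gelt y.
Proof.
apply/galg_eqP=> z; rewrite gcoefM (bigD1 x) //= !gcoef_elt.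
rewrite eqxx mul1r big1 ?addr0 => [|w /negPf wx].
  by rewrite -[(_ * z)%g == y](inj_eq (mulgI x)) mulKVg.
by rewrite gcoef_elt wx mul0r.
Qed.

Lemma galgZl c (a b : galg k gT) : (c *: a) * b = c *: (a * b).
Proof.
apply/galg_eqP=> z; rewrite gcoefZ !gcoefM mulr_sumr.
by apply: eq_bigr => y _; rewrite gcoefZ mulrA.
Qed.

Lemma galgZr c (a b : galg k gT) : a * (c *: b) = c *: (a * b).
Proof.
apply/galg_eqP=> z; rewrite gcoefZ !gcoefM mulr_sumr.
by apply: eq_bigr => y _; rewrite gcoefZ mulrCA.
Qed.

Lemma galgE (a : galg k gT) : a = \sum_x gcoef a x *: gelt x.
Proof.
apply/ffunP=> z; rewrite sum_ffunE (bigD1 z) //= big1 ?addr0 => [|x xz].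
  by rewrite !ffunE eqxx /= [_ *: _]mulr1.
by rewrite !ffunE eq_sym (negPf xz) scaler0.
Qed.

Definition gscal (c : k) : galg k gT := c *: (1 : galg k gT).

Lemma gscal_is_zmod_morphism : zmod_morphism gscal.
Proof. by move=> c d; rewrite /gscal scalerBl. Qed.
HB.instance Definition _ :=
  GRing.isZmodMorphism.Build k (galg k gT) gscal gscal_is_zmod_morphism.

Lemma gscal_is_monoid_morphism : monoid_morphism gscal.
Proof.
split=> [|c d]; first exact: scale1r.
by rewrite /gscal galgZl mul1r scalerA.
Qed.
HB.instance Definition _ :=
  GRing.isMonoidMorphism.Build k (galg k gT) gscal gscal_is_monoid_morphism.

Lemma gscalC : central gscal.
Proof. by move=> c a; rewrite /gscal galgZl galgZr mul1r mulr1. Qed.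

End GroupAlgebra.

(* gscal on the converse ring: it makes a k[G]-module a right k-module. *)
Definition gscalc (k : comPzRingType) (gT : finGroupType) : k^c -> galg k gT :=
  @gscal k gT.
Section GscalC.
Variables (k : comPzRingType) (gT : finGroupType).
Lemma gscalc_is_zmod_morphism : zmod_morphism (@gscalc k gT).
Proof. exact: (raddfB (@gscal k gT)). Qed.
HB.instance Definition _ :=
  GRing.isZmodMorphism.Build k^c (galg k gT) (@gscalc k gT)
    gscalc_is_zmod_morphism.
Lemma gscalc_is_monoid_morphism : monoid_morphism (@gscalc k gT).
Proof.
split=> [|c d]; first exact: (rmorph1 (@gscal k gT)).
rewrite -[RHS](rmorphM (@gscal k gT)); congr (gscal _ _); exact: mulrC.
Qed.
HB.instance Definition _ :=
  GRing.isMonoidMorphism.Build k^c (galg k gT) (@gscalc k gT)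
    gscalc_is_monoid_morphism.
End GscalC.

Section GalgMap.
Variables (k : comPzRingType) (gT hT : finGroupType) (f : gT -> hT).

Definition glin (a : galg k gT) : galg k hT := \sum_x gcoef a x *: gelt k (f x).

Lemma glin_is_zmod_morphism : zmod_morphism glin.
Proof.
move=> a b; rewrite /glin -sumrB; apply: eq_bigr => x _.
by rewrite /gcoef !ffunE scalerBl.
Qed.
HB.instance Definition _ :=
  GRing.isZmodMorphism.Build (galg k gT) (galg k hT) glin glin_is_zmod_morphism.

Lemma glinZ c a : glin (c *: a) = c *: glin a.
Proof.
by rewrite /glin scaler_sumr; apply: eq_bigr => x _; rewrite gcoefZ scalerA.
Qed.

Lemma glin_elt x : glin (gelt k x) = gelt k (f x).
Proof.
rewrite /glin (bigD1 x) //= big1 ?addr0 => [|y /negPf yx].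
  by rewrite gcoef_elt eqxx scale1r.
by rewrite gcoef_elt yx scale0r.
Qed.

Definition galg_map of {morph f : x y / (x * y)%g} := glin.
Definition galg_antimap of (forall x y, f (x * y)%g = (f y * f x)%g)
  : (galg k gT)^c -> galg k hT := glin.

Let f1 : (forall x y, f x = f (x * y)%g -> f y = 1%g) -> f 1%g = 1%g.
Proof. by move=> h; apply: (h 1%g); rewrite mulg1. Qed.

Lemma galg_map_is_monoid_morphism fM : monoid_morphism (@galg_map fM).
Proof.
split=> [|a b].
  rewrite -gelt1 /galg_map glin_elt f1 // => x y.
  by rewrite fM -{1}[f x]mulg1 => /mulgI.
rewrite /galg_map {1}[a]galgE {1}[b]galgE.
rewrite mulr_suml [LHS]raddf_sum [in RHS]/glin mulr_suml.
apply: eq_bigr => x _; rewrite mulr_sumr [LHS]raddf_sum mulr_sumr.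
apply: eq_bigr => y _; rewrite /= !galgZl !galgZr. rewrite !glinZ.
by rewrite -!geltM glin_elt fM.
Qed.
HB.instance Definition _ fM :=
  GRing.isZmodMorphism.Build (galg k gT) (galg k hT) (galg_map fM)
    glin_is_zmod_morphism.
HB.instance Definition _ fM :=
  GRing.isMonoidMorphism.Build (galg k gT) (galg k hT) (galg_map fM)
    (galg_map_is_monoid_morphism fM).

Lemma galg_antimap_is_monoid_morphism fA : monoid_morphism (@galg_antimap fA).
Proof.
split=> [|a b].
  rewrite -[1]/(gelt k 1%g) /galg_antimap glin_elt f1 // => x y.
  by rewrite fA -{1}[f x]mul1g => /mulIg.
rewrite /galg_antimap {1}[a]galgE {1}[b]galgE -[_ * _]/(GRing.mul (_ : galg _ _) _).
rewrite mulr_sumr [LHS]raddf_sum [in RHS]/glin mulr_suml.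
apply: eq_bigr => x _; rewrite mulr_suml [LHS]raddf_sum mulr_sumr.
apply: eq_bigr => y _; rewrite /= !galgZl !galgZr. rewrite !glinZ scalerA mulrC -scalerA.
by rewrite -!geltM glin_elt fA.
Qed.
HB.instance Definition _ fA :=
  GRing.isZmodMorphism.Build (galg k gT)^c (galg k hT) (galg_antimap fA)
    glin_is_zmod_morphism.
HB.instance Definition _ fA :=
  GRing.isMonoidMorphism.Build (galg k gT)^c (galg k hT) (galg_antimap fA)
    (galg_antimap_is_monoid_morphism fA).

End GalgMap.

(* Balancedness over a group algebra need only be checked on the scalars and
   on the group elements. *)
Lemma balanced_galg (k : comPzRingType) (gT : finGroupType)
    (A : lmodType (galg k gT)^c) (B : lmodType (galg k gT)) (Z : zmodType)
    (beta : A -> B -> Z) :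
  (forall a a' b, beta (a + a') b = beta a b + beta a' b) ->
  (forall a b b', beta a (b + b') = beta a b + beta a b') ->
  (forall a c b, beta ((gscal gT c : (galg k gT)^c) *: a) b
                 = beta a (gscal gT c *: b)) ->
  (forall a x b, beta ((gelt k x : (galg k gT)^c) *: a) b
                 = beta a (gelt k x *: b)) ->
  balanced beta.
Proof.
move=> bDl bDr bc bx; split=> // a r b.
have beta0l b' : beta 0 b' = 0.
  by apply: (addIr (beta 0 b')); rewrite -bDl !add0r.
have beta0r a' : beta a' 0 = 0.
  by apply: (addIr (beta a' 0)); rewrite -bDr !add0r.
have -> : r = \sum_x gscal gT (gcoef r x) * gelt k x.
  by rewrite {1}[r]galgE; apply: eq_bigr => x _; rewrite /gscal galgZl mul1r.
rewrite !scaler_suml (big_morph (beta^~ b) (fun u v => bDl u v b) (beta0l b)).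
rewrite (big_morph (beta a) (bDr a) (beta0r a)); apply: eq_bigr => x _.
by rewrite -[in RHS]scalerA -bc -bx scalerA.
Qed.

Record linrep (k : comPzRingType) (gT : finGroupType) := LinRep {
  rep_space : lmodType k;
  rep_op : gT -> {linear rep_space -> rep_space};
  rep_op1 : rep_op 1%g =1 id;
  rep_opM : forall x y, rep_op (x * y)%g =1 rep_op x \o rep_op y
}.

Definition rep_mod (k : comPzRingType) (gT : finGroupType) (r : linrep k gT)
  : Type := rep_space r.

Section RepMod.
Variables (k : comPzRingType) (gT : finGroupType) (r : linrep k gT).

HB.instance Definition _ := GRing.Zmodule.on (rep_mod r).

Let scale (a : galg k gT) (v : rep_mod r) : rep_mod r :=
  \sum_x gcoef a x *: rep_op r x v.

Let scaleA a b v : scale a (scale b v) = scale (a * b) v.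
Proof.
rewrite /scale; under [RHS]eq_bigr => z _ do rewrite gcoefM scaler_suml.
rewrite [RHS]exchange_big; apply: eq_bigr => x _ /=.
rewrite [RHS](reindex_inj (mulgI x)) linear_sum scaler_sumr.
by apply: eq_bigr => y _; rewrite mulKg rep_opM linearZ scalerA.
Qed.

Let scale_elt x v : scale (gelt k x) v = rep_op r x v.
Proof.
rewrite /scale (bigD1 x) //= big1 ?addr0 => [|y /negPf yx].
  by rewrite gcoef_elt eqxx scale1r.
by rewrite gcoef_elt yx scale0r.
Qed.

Let scale1 : left_id 1 scale.
Proof. by move=> v; rewrite -gelt1 scale_elt rep_op1. Qed.

Let scaleDr : right_distributive scale +%R.
Proof.
move=> a v w; rewrite /scale -big_split; apply: eq_bigr => x _ /=.
by rewrite linearD scalerDr.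
Qed.

Let scaleDl v : {morph scale^~ v : a b / a + b}.
Proof.
move=> a b; rewrite /scale -big_split; apply: eq_bigr => x _ /=.
by rewrite gcoefD scalerDl.
Qed.

HB.instance Definition _ :=
  GRing.Zmodule_isLmodule.Build (galg k gT) (rep_mod r)
    scaleA scale1 scaleDr scaleDl.

Lemma rep_modZ (a : galg k gT) (v : rep_mod r) :
  a *: v = \sum_x gcoef a x *: rep_op r x v :> rep_space r.
Proof. by []. Qed.

Lemma rep_mod_elt x (v : rep_mod r) : gelt k x *: v = rep_op r x v.
Proof. exact: scale_elt. Qed.

Lemma rep_mod_scal c (v : rep_mod r) :
  gscal gT c *: v = c *: (v : rep_space r).
Proof.
rewrite rep_modZ (bigD1 1%g) //= big1 ?addr0 => [|x /negPf x1].
  by rewrite gcoefZ gcoef_elt eqxx mulr1 rep_op1.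
by rewrite gcoefZ gcoef_elt x1 mulr0 scale0r.
Qed.

End RepMod.

Section RepMap.
Variables (k : comPzRingType) (gT : finGroupType) (r r' : linrep k gT).
Variable phi : {linear rep_space r -> rep_space r'}.

Definition rep_map of (forall x v, phi (rep_op r x v) = rep_op r' x (phi v)) :
  rep_mod r -> rep_mod r' := phi.

Hypothesis phiC : forall x v, phi (rep_op r x v) = rep_op r' x (phi v).

Lemma rep_map_is_zmod_morphism : zmod_morphism (rep_map phiC).
Proof. exact: (raddfB phi). Qed.
Lemma rep_map_is_scalable : scalable (rep_map phiC).
Proof.
move=> a v; rewrite [a *: v]rep_modZ rep_modZ /rep_map linear_sum.
by apply: eq_bigr => x _; rewrite linearZ phiC.
Qed.
HB.instance Definition _ := GRing.isZmodMorphism.Build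
  (rep_mod r) (rep_mod r') (rep_map phiC) rep_map_is_zmod_morphism.
HB.instance Definition _ := GRing.isScalable.Build (galg k gT)
  (rep_mod r) (rep_mod r') *:%R (rep_map phiC) rep_map_is_scalable.
End RepMap.

Section RestrMap.
Variables (R S : pzRingType) (f : {rmorphism R -> S}) (M N : lmodType S).

Definition restr_map (u : {linear M -> N}) : restr f M -> restr f N := u.

Variable u : {linear M -> N}.
Lemma restr_map_is_zmod_morphism : zmod_morphism (restr_map u).
Proof. exact: (raddfB u). Qed.
Lemma restr_map_is_scalable : scalable (restr_map u).
Proof. by move=> a m; rewrite /restr_map !restrZ linearZ. Qed.
HB.instance Definition _ := GRing.isZmodMorphism.Build
  (restr f M) (restr f N) (restr_map u) restr_map_is_zmod_morphism.
HB.instance Definition _ := GRing.isScalable.Build R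
  (restr f M) (restr f N) *:%R (restr_map u) restr_map_is_scalable.
End RestrMap.

Section RestrMul.
Variables (R S : pzRingType) (f : {rmorphism R -> S}) (M : lmodType S) (s : S).

Definition restr_mul of (forall r, s * f r = f r * s) :
  restr f M -> restr f M := fun m => s *: (m : M).

Hypothesis sC : forall r, s * f r = f r * s.
Lemma restr_mulE m : restr_mul sC m = s *: (m : M).
Proof. by []. Qed.
Lemma restr_mul_is_zmod_morphism : zmod_morphism (restr_mul sC).
Proof. by move=> m n; rewrite /restr_mul scalerBr. Qed.
Lemma restr_mul_is_scalable : scalable (restr_mul sC).
Proof. by move=> a m; rewrite /restr_mul !restrZ !scalerA sC. Qed.
HB.instance Definition _ := GRing.isZmodMorphism.Build
  (restr f M) (restr f M) (restr_mul sC) restr_mul_is_zmod_morphism.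
HB.instance Definition _ := GRing.isScalable.Build R
  (restr f M) (restr f M) *:%R (restr_mul sC) restr_mul_is_scalable.
End RestrMul.

Lemma ktensor_ext (k : comPzRingType) (R : pzRingType) (i : {rmorphism k -> R})
    (iC : central i) (A : lmodType R^c) (B : lmodType R) (Z : zmodType)
    (f g : {additive ktensor iC A B -> Z}) :
  (forall a b, f (tens a b) = g (tens a b)) -> f =1 g.
Proof. exact: tensor_ext. Qed.

Section KTensorMap.
Variables (k : comPzRingType) (R : pzRingType) (i : {rmorphism k -> R}).
Variables (iC : central i) (A A' : lmodType R^c) (B B' : lmodType R).

Lemma ktensor_scalable (A1 A2 : lmodType R^c) (B1 B2 : lmodType R)
    (phi : {additive ktensor iC A1 B1 -> ktensor iC A2 B2}) :
  (forall c a b, phi (tens ((i c : R^c) *: a) b) = c *: phi (tens a b)) ->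
  scalable phi.
Proof.
move=> phiZ c.
apply: (@ktensor_ext _ _ _ _ _ _ _ (phi \o *:%R c) ( *:%R c \o phi)) => a b /=.
by rewrite ktensorZ phiZ.
Qed.

Definition ktmap (f : {linear A -> A'}) (g : {linear B -> B'}) :
  ktensor iC A B -> ktensor iC A' B' := tmap f g.

Variables (f : {linear A -> A'}) (g : {linear B -> B'}).
Lemma ktmapE a b : ktmap f g (tens a b) = tens (f a) (g b).
Proof. exact: tmapE. Qed.

Lemma ktmap_is_zmod_morphism : zmod_morphism (ktmap f g).
Proof. exact: (raddfB (tmap f g)). Qed.
HB.instance Definition _ := GRing.isZmodMorphism.Build
  (ktensor iC A B) (ktensor iC A' B') (ktmap f g) ktmap_is_zmod_morphism.
Lemma ktmap_is_scalable : scalable (ktmap f g).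
Proof.
apply: ktensor_scalable => c a b.
by rewrite /= !ktmapE ktensorZ linearZ.
Qed.
HB.instance Definition _ := GRing.isScalable.Build k
  (ktensor iC A B) (ktensor iC A' B') *:%R (ktmap f g) ktmap_is_scalable.

End KTensorMap.


Record biset (gT hT : finGroupType) := Biset {
  bcar :> finType;
  bl : gT -> bcar -> bcar;
  br : bcar -> hT -> bcar;
  bl1 : forall u, bl 1%g u = u;
  blM : forall x y u, bl (x * y)%g u = bl x (bl y u);
  br1 : forall u, br u 1%g = u;
  brM : forall u x y, br u (x * y)%g = br (br u x) y;
  blr : forall x u y, bl x (br u y) = br (bl x u) y
}.

Section BisetTensor.
Variables (gT hT lT : finGroupType) (U : biset gT hT) (V : biset hT lT).
Implicit Types (u : U) (v : V) (p : U * V).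

(* The orbit of p under h(u, v) = (u h^-1, h v). *)
Definition borbit p : {set U * V} :=
  [set (br p.1 h^-1%g, bl h p.2) | h : hT].
Definition borbits : {set {set U * V}} := [set borbit p | p : U * V].
Definition btensor : finType := {O : {set U * V} | O \in borbits}.

Lemma borbitP p : borbit p \in borbits.
Proof. exact: imset_f. Qed.
Definition btens u v : btensor := exist (fun S => S \in borbits) _ (borbitP (u, v)).

Let lset g (O : {set U * V}) := [set (bl g p.1, p.2) | p in O].
Let rset (O : {set U * V}) l := [set (p.1, br p.2 l) | p in O].

Let lset_orbit g p : lset g (borbit p) = borbit (bl g p.1, p.2).
Proof. by rewrite /lset -imset_comp; apply: eq_imset => h /=; rewrite blr. Qed.
Let rset_orbit p l : rset (borbit p) l = borbit (p.1, br p.2 l).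
Proof. by rewrite /rset -imset_comp; apply: eq_imset => h /=; rewrite blr. Qed.

Let lsetP g (O : btensor) : lset g (val O) \in borbits.
Proof. by case: O => ? /= /imsetP[p _ ->]; rewrite lset_orbit borbitP. Qed.
Let rsetP (O : btensor) l : rset (val O) l \in borbits.
Proof. by case: O => ? /= /imsetP[p _ ->]; rewrite rset_orbit borbitP. Qed.

Let btl g (O : btensor) : btensor := exist (fun S => S \in borbits) _ (lsetP g O).
Let btr (O : btensor) l : btensor := exist (fun S => S \in borbits) _ (rsetP O l).

Let btlE g u v : btl g (btens u v) = btens (bl g u) v.
Proof. by apply: val_inj; rewrite /= lset_orbit. Qed.
Let btrE u v l : btr (btens u v) l = btens u (br v l).
Proof. by apply: val_inj; rewrite /= rset_orbit. Qed.

Lemma btens_surj (O : btensor) : exists u v, O = btens u v.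
Proof.
case: O => O OP; have /imsetP[[u v] _ defO] := OP.
by exists u, v; apply: val_inj.
Qed.

Let btl1 O : btl 1%g O = O.
Proof. by have [u [v ->]] := btens_surj O; rewrite btlE bl1. Qed.
Let btlM x y O : btl (x * y)%g O = btl x (btl y O).
Proof. by have [u [v ->]] := btens_surj O; rewrite !btlE blM. Qed.
Let btr1 O : btr O 1%g = O.
Proof. by have [u [v ->]] := btens_surj O; rewrite btrE br1. Qed.
Let btrM O x y : btr O (x * y)%g = btr (btr O x) y.
Proof. by have [u [v ->]] := btens_surj O; rewrite !btrE brM. Qed.
Let btlr x O y : btl x (btr O y) = btr (btl x O) y.
Proof. by have [u [v ->]] := btens_surj O; rewrite !(btlE, btrE). Qed.

Definition biset_tensor : biset gT lT := Biset btl1 btlM btr1 btrM btlr.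

Lemma btens_eqP u v u' v' :
  btens u v = btens u' v' <->
  exists h : hT, u' = br u h^-1%g /\ v' = bl h v.
Proof.
split=> [/(congr1 val) /= uv|[h [-> ->]]].
  have: (u', v') \in borbit (u', v').
    by apply/imsetP; exists 1%g; rewrite //= invg1 br1 bl1.
  by rewrite -uv => /imsetP[h _ [-> ->]]; exists h.
apply/val_inj/setP => p /=; apply/imsetP/imsetP => -[x _ ->] /=.
  exists (x * h^-1)%g; rewrite //= -brM -blM mulgKV.
  by rewrite invMg invgK mulKg.
by exists (x * h)%g; rewrite //= -brM -blM invMg.
Qed.

Lemma biset_tensor_lE g u v :
  bl g (btens u v : biset_tensor) = btens (bl g u) v.
Proof. exact: btlE. Qed.
Lemma biset_tensor_rE u v l :
  br (btens u v : biset_tensor) l = btens u (br v l).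
Proof. exact: btrE. Qed.

End BisetTensor.

Section ElementaryBisets.
Variable bT : finGroupType.

Section Res.
Variable A : {group bT}.
Let rl (a : subg_of A) (b : bT) : bT := (sgval a * b)%g.
Let rl1 b : rl 1%g b = b.
Proof. exact: mul1g. Qed.
Let rlM x y b : rl (x * y)%g b = rl x (rl y b).
Proof. by rewrite /rl mulgA. Qed.
Let rlr x (b y : bT) : rl x (b * y)%g = (rl x b * y)%g.
Proof. exact: mulgA. Qed.
Definition res_biset : biset (subg_of A) bT :=
  Biset rl1 rlM (@mulg1 bT) (@mulgA bT) rlr.
End Res.

(* As N is normal, coset_of N, whose elements are the cosets of N in 'N(N), is
   the whole quotient group. *)
Section Def.
Variables (N : {group bT}) (nN : (N <| [set: bT])%g).
Let dr (c : coset_of N) (b : bT) : coset_of N := (c * coset N b)%g.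
Let dr1 c : dr c 1%g = c.
Proof. by rewrite /dr morph1 mulg1. Qed.
Let drM c x y : dr c (x * y)%g = dr (dr c x) y.
Proof.
by rewrite /dr morphM ?mulgA //; apply: (subsetP (normal_norm nN)).
Qed.
Let dlr x c y : (x * dr c y)%g = dr (x * c)%g y.
Proof. exact: mulgA. Qed.
Definition def_biset : biset (coset_of N) bT :=
  Biset (@mul1g (coset_of N)) (fun x y c => esym (mulgA x y c)) dr1 drM dlr.
End Def.

Section Iso.
Variables (cT : finGroupType) (alpha : {morphism [set: bT] >-> cT}).
Let ir (c : cT) (b : bT) : cT := (c * alpha b)%g.
Let ir1 c : ir c 1%g = c.
Proof. by rewrite /ir morph1 mulg1. Qed.
Let irM c x y : ir c (x * y)%g = ir (ir c x) y.
Proof. by rewrite /ir morphM ?inE ?mulgA. Qed.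
Let ilr x c y : (x * ir c y)%g = ir (x * c)%g y.
Proof. exact: mulgA. Qed.
Definition iso_biset of bijective alpha : biset cT bT :=
  Biset (@mul1g cT) (fun x y c => esym (mulgA x y c)) ir1 irM ilr.
End Iso.

End ElementaryBisets.

(* The (kG, kH)-bimodule kU: the right action of kH is a left action of its
   converse, see belt_r, and the left action of G is biset_lact. *)
Definition biset_mod (k : comPzRingType) (gT hT : finGroupType)
  (U : biset gT hT) : Type := {ffun U -> k^o}.

Section BisetMod.
Variables (k : comPzRingType) (gT hT : finGroupType) (U : biset gT hT).
Local Notation kU := (biset_mod k U).

HB.instance Definition _ := GRing.Zmodule.on kU.

Definition bcoef (phi : kU) (u : U) : k := (phi : {ffun U -> k^o}) u.
Definition belt (u : U) : kU := [ffun w => (w == u)%:R].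

Let scale (a : (galg k hT)^c) (phi : kU) : kU :=
  [ffun w => \sum_h gcoef a h * bcoef phi (br w h^-1%g)].

Let scaleA a b phi : scale a (scale b phi) = scale (a * b) phi.
Proof.
apply/ffunP=> w; rewrite !ffunE.
under eq_bigr => h _ do rewrite /bcoef ffunE mulr_sumr.
under [RHS]eq_bigr => z _ do rewrite [gcoef _ _]gcoefM mulr_suml.
rewrite exchange_big [RHS]exchange_big; apply: eq_bigr => y _ /=.
rewrite [RHS](reindex_inj (mulgI y)); apply: eq_bigr => h _ /=.
by rewrite mulKg invMg brM mulrCA mulrA.
Qed.

Let scale_elt (h : hT) u : scale (gelt k h) (belt u) = belt (br u h).
Proof.
apply/ffunP=> w; rewrite !ffunE (bigD1 h) //= big1 ?addr0 => [|y /negPf yh].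
  rewrite gcoef_elt eqxx mul1r /bcoef ffunE; congr ((nat_of_bool _)%:R).
  by apply/eqP/eqP=> [<-|->]; rewrite -brM (mulgV, mulVg) br1.
by rewrite gcoef_elt yh mul0r.
Qed.

Let scale1 : left_id 1 scale.
Proof.
move=> phi; apply/ffunP=> w; rewrite ffunE (bigD1 1%g) //=.
rewrite [gcoef _ _]gcoef_elt eqxx mul1r invg1 br1 big1 ?addr0 // => h /negPf h1.
by rewrite [gcoef _ _]gcoef_elt h1 mul0r.
Qed.

Let scaleDr : right_distributive scale +%R.
Proof.
move=> a phi psi; apply/ffunP=> w; rewrite !ffunE -big_split /=.
by apply: eq_bigr => h _; rewrite -mulrDr /bcoef ffunE.
Qed.

Let scaleDl phi : {morph scale^~ phi : a b / a + b}.
Proof.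
move=> a b; apply/ffunP=> w; rewrite !ffunE -big_split /=.
by apply: eq_bigr => h _; rewrite -mulrDl [gcoef _ _]gcoefD.
Qed.

HB.instance Definition _ := GRing.Zmodule_isLmodule.Build (galg k hT)^c kU
  scaleA scale1 scaleDr scaleDl.

Lemma belt_r (h : hT) u : (gelt k h : (galg k hT)^c) *: belt u = belt (br u h).
Proof. exact: scale_elt. Qed.

Lemma bcoefE (phi : kU) :
  phi = \sum_u (gscal hT (bcoef phi u) : (galg k hT)^c) *: belt u.
Proof.
have scalE c u w :
    bcoef ((gscal hT c : (galg k hT)^c) *: belt u) w = c * (w == u)%:R.
  rewrite /bcoef ffunE (bigD1 1%g) //= big1 ?addr0 => [|h /negPf h1].
    by rewrite gcoefZ gcoef_elt eqxx mulr1 invg1 br1 /bcoef ffunE.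
  by rewrite gcoefZ gcoef_elt h1 mulr0 mul0r.
apply/ffunP=> w; rewrite sum_ffunE (bigD1 w) //= big1 ?addr0 => [|u uw].
  by rewrite -[RHS]/(bcoef _ w) scalE eqxx mulr1.
by rewrite -[LHS]/(bcoef _ w) scalE eq_sym (negPf uw) mulr0.
Qed.

Definition biset_lact (g : gT) (phi : kU) : kU :=
  [ffun w => bcoef phi (bl g^-1%g w)].

Lemma biset_lact_is_zmod_morphism g : zmod_morphism (biset_lact g).
Proof. by move=> phi psi; apply/ffunP=> w; rewrite !ffunE /bcoef !ffunE. Qed.
Lemma biset_lact_is_scalable g : scalable (biset_lact g).
Proof.
move=> a phi; apply/ffunP=> w; rewrite !ffunE /bcoef ffunE.
by apply: eq_bigr => h _; rewrite /bcoef ffunE blr.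
Qed.
HB.instance Definition _ g :=
  GRing.isZmodMorphism.Build kU kU (biset_lact g)
    (biset_lact_is_zmod_morphism g).
HB.instance Definition _ g :=
  GRing.isScalable.Build (galg k hT)^c kU kU *:%R (biset_lact g)
    (biset_lact_is_scalable g).

Lemma belt_l (g : gT) u : biset_lact g (belt u) = belt (bl g u).
Proof.
apply/ffunP=> w; rewrite !ffunE /bcoef ffunE; congr ((nat_of_bool _)%:R).
by apply/eqP/eqP=> [<-|->]; rewrite -blM (mulgV, mulVg) bl1.
Qed.

Lemma biset_lact1 : biset_lact 1%g =1 id.
Proof. by move=> phi; apply/ffunP=> w; rewrite ffunE invg1 bl1. Qed.
Lemma biset_lactM x y : biset_lact (x * y)%g =1 biset_lact x \o biset_lact y.
Proof.
by move=> phi; apply/ffunP=> w; rewrite !ffunE /bcoef ffunE invMg blM.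
Qed.

End BisetMod.

Section BisetFunctor.
Variables (k : comPzRingType) (gT hT : finGroupType) (U : biset gT hT).

Section Object.
Variable M : lmodType (galg k hT).

Let T : lmodType k := ktensor (@gscalC k hT) (biset_mod k U) M.
Let op (g : gT) : {linear T -> T} :=
  ktmap (@biset_lact k gT hT U g) (idfun : {linear M -> M}).

Let op1 : op 1%g =1 id.
Proof.
apply: (ktensor_ext (f := op 1%g) (g := idfun)) => phi m.
by rewrite /op /= ktmapE /= biset_lact1.
Qed.

Let opM x y : op (x * y)%g =1 op x \o op y.
Proof.
apply: (ktensor_ext (f := op (x * y)%g) (g := op x \o op y)) => phi m /=.
by rewrite /= !ktmapE /= biset_lactM.
Qed.

Definition biset_rep : linrep k gT := LinRep op1 opM.
End Object.

Section Morphism.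
Variables (M N : lmodType (galg k hT)) (f : {linear M -> N}).

Let phi : {linear rep_space (biset_rep M) -> rep_space (biset_rep N)} :=
  ktmap (idfun : {linear biset_mod k U -> biset_mod k U}) f.

Let phiC g t : phi (rep_op (biset_rep M) g t) = rep_op (biset_rep N) g (phi t).
Proof.
apply: (ktensor_ext (f := phi \o rep_op (biset_rep M) g)
                    (g := rep_op (biset_rep N) g \o phi)) => u m /=.
by rewrite /= !ktmapE.
Qed.

Definition biset_map : {linear rep_mod (biset_rep M) -> rep_mod (biset_rep N)} :=
  rep_map phiC.

Lemma biset_mapE u m : biset_map (tens u m) = tens u (f m).
Proof. exact: ktmapE. Qed.
End Morphism.

Let biset_map_id (M : mod_cat (galg k hT)) :
  biset_map (idm M) = idm (rep_mod (biset_rep M) : mod_cat (galg k gT)).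
Proof.
by apply/linear_ext/tensor_ext => u m; rewrite [LHS]biset_mapE.
Qed.

Let biset_map_comp (L M N : mod_cat (galg k hT)) (g : chom M N) (f : chom L M) :
  biset_map (ccomp g f)
  = ccomp (biset_map g : @chom (mod_cat (galg k gT)) _ _) (biset_map f).
Proof.
apply/linear_ext/tensor_ext => u m; rewrite [LHS]biset_mapE; symmetry.
exact: etrans (congr1 (biset_map g) (biset_mapE f u m)) (biset_mapE g u (f m)).
Qed.

Definition biset_functor :
    functor (mod_cat (galg k hT)) (mod_cat (galg k gT)) :=
  @Functor (mod_cat (galg k hT)) (mod_cat (galg k gT))
    (fun M => rep_mod (biset_rep M)) biset_map biset_map_id biset_map_comp.

End BisetFunctor.

Section OuterTensor.
Variables (k : comPzRingType) (gT hT : finGroupType).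

Lemma central_id : central (idfun : {rmorphism k -> k}).
Proof. by move=> c d; apply: mulrC. Qed.

Section Object.
Variables (M : lmodType (galg k gT)) (N : lmodType (galg k hT)).

Let Mk : lmodType k^c := restr (@gscalc k gT) M.
Let Nk : lmodType k := restr (@gscal k hT) N.
Let T : lmodType k := ktensor central_id Mk Nk.

Let gC x c : gelt k x * gscalc gT c = gscalc gT c * gelt k x.
Proof. by symmetry; apply: gscalC. Qed.
Let hC y c : gelt k y * gscal hT c = gscal hT c * gelt k y.
Proof. by symmetry; apply: gscalC. Qed.

Let op (p : gT * hT) : {linear T -> T} :=
  ktmap (restr_mul (gC p.1) : {linear Mk -> Mk})
        (restr_mul (hC p.2) : {linear Nk -> Nk}).

Let op1 : op 1%g =1 id.
Proof.
apply: (ktensor_ext (f := op 1%g) (g := idfun)) => m n.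
by rewrite /op /= ktmapE /= !restr_mulE !gelt1 !scale1r.
Qed.

Let opM p q : op (p * q)%g =1 op p \o op q.
Proof.
apply: (ktensor_ext (f := op (p * q)%g) (g := op p \o op q)) => m n /=.
by rewrite /= !ktmapE /= !restr_mulE !geltM !scalerA.
Qed.

Definition outer_rep : linrep k (gT * hT)%type := LinRep op1 opM.

Lemma outer_repE x y (m : M) (n : N) :
  rep_op outer_rep (x, y) (tens (m : restr (@gscalc k gT) M) (n : restr _ N))
  = tens (gelt k x *: m : restr (@gscalc k gT) M)
         (gelt k y *: n : restr (@gscal k hT) N).
Proof. exact: ktmapE. Qed.

End Object.

Section Morphism.
Variables (M M' : lmodType (galg k gT)) (N N' : lmodType (galg k hT)).
Variables (f : {linear M -> M'}) (g : {linear N -> N'}).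

Let phi : {linear rep_space (outer_rep M N) -> rep_space (outer_rep M' N')} :=
  ktmap
    (restr_map f : {linear restr (@gscalc k gT) M -> restr (@gscalc k gT) M'})
    (restr_map g : {linear restr (@gscal k hT) N -> restr (@gscal k hT) N'}).

Let phiC p t :
  phi (rep_op (outer_rep M N) p t) = rep_op (outer_rep M' N') p (phi t).
Proof.
apply: (ktensor_ext (f := phi \o rep_op (outer_rep M N) p)
                    (g := rep_op (outer_rep M' N') p \o phi)) => m n /=.
by rewrite /= !ktmapE /= /restr_map /restr_mul !linearZ.
Qed.

Definition outer_map :
    {linear rep_mod (outer_rep M N) -> rep_mod (outer_rep M' N')} :=
  rep_map phiC.

Lemma outer_mapE m n :
  outer_map (tens m n)
  = tens (f m : restr (@gscalc k gT) M') (g n : restr (@gscal k hT) N').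
Proof. exact: ktmapE. Qed.
End Morphism.

Local Notation C := (prod_cat (mod_cat (galg k gT)) (mod_cat (galg k hT))).
Local Notation D := (mod_cat (galg k (gT * hT)%type)).

Let outer_obj (p : C) : D := rep_mod (outer_rep p.1 p.2).
Let outer_mor (p q : C) (f : chom p q) : chom (outer_obj p) (outer_obj q) :=
  outer_map f.1 f.2.

Let outer_mor_id p : outer_mor (idm p) = idm (outer_obj p).
Proof.
by apply/linear_ext/tensor_ext => m n; rewrite [LHS]outer_mapE.
Qed.

Let outer_mor_comp p q r (g : chom q r) (f : chom p q) :
  outer_mor (ccomp g f) = ccomp (outer_mor g) (outer_mor f).
Proof.
apply/linear_ext/tensor_ext => m n; rewrite [LHS]outer_mapE; symmetry.
exact: etrans (congr1 (outer_mor g) (outer_mapE f.1 f.2 m n))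
              (outer_mapE g.1 g.2 (f.1 m) (f.2 n)).
Qed.

Definition outer_functor : functor C D := Functor outer_mor_id outer_mor_comp.

End OuterTensor.

Section Subgroups.
Variables (gT hT lT : finGroupType).
Variables (X : {group gT * hT}) (Y : {group hT * lT}).

Definition k1 := [set g : gT | (g, 1%g) \in X].
Definition k2 := [set h : hT | (1%g, h) \in X].

Lemma k1_group_set : group_set k1.
Proof.
apply/group_setP; split=> [|x y]; rewrite !inE; first exact: group1.
move=> xX yX; suff -> : ((x * y)%g, 1%g) = ((x, 1%g) * (y, 1%g))%g :> gT * hT.
  exact: groupM.
by congr (_, _); rewrite mulg1.
Qed.
Canonical k1_group := Group k1_group_set.

Lemma k2_group_set : group_set k2.
Proof.
apply/group_setP; split=> [|x y]; rewrite !inE; first exact: group1.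
move=> xX yX; suff -> : (1%g, (x * y)%g) = ((1%g, x) * (1%g, y))%g :> gT * hT.
  exact: groupM.
by congr (_, _); rewrite mulg1.
Qed.
Canonical k2_group := Group k2_group_set.

Definition star := [set p : gT * lT |
  [exists h : hT, ((p.1, h) \in X) && ((h, p.2) \in Y)]].

Lemma star_group_set : group_set star.
Proof.
apply/group_setP; split=> [|p q]; rewrite !inE.
  by apply/existsP; exists 1%g; rewrite !group1.
case/existsP=> h /andP[hX hY] /existsP[h' /andP[hX' hY']].
by apply/existsP; exists (h * h')%g; rewrite (groupM hX hX') (groupM hY hY').
Qed.
Canonical star_group := Group star_group_set.

Definition fibprod := [set p : subg_of X * subg_of Y |
  (sgval p.1).2 == (sgval p.2).1].

Lemma fibprod_group_set : group_set fibprod.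
Proof.
apply/group_setP; split=> [|p q]; rewrite !inE //=.
by move=> /eqP-> /eqP->.
Qed.
Canonical fibprod_group := Group fibprod_group_set.

End Subgroups.

Section KGroup.
Variables (gT hT lT : finGroupType).
Variables (X : {group gT * hT}) (Y : {group hT * lT}).
Definition kk : {group hT} := [group of k2 X :&: k1 Y].
End KGroup.

Section ExtTensor.
Variables (k : comPzRingType) (gT hT lT : finGroupType).
Variables (X : {group gT * hT}) (Y : {group hT * lT}).
Local Notation kA := (galg k (subg_of (kk X Y))).
Local Notation kX := (galg k (subg_of X)).
Local Notation kY := (galg k (subg_of Y)).

Lemma kk_inX h : h \in kk X Y -> (1%g, h) \in X.
Proof. by rewrite !inE => /andP[]. Qed.
Lemma kk_inY h : h \in kk X Y -> (h, 1%g) \in Y.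
Proof. by rewrite !inE => /andP[]. Qed.

Definition kk_toX (h : subg_of (kk X Y)) : subg_of X :=
  subg X (1%g, (sgval h)^-1%g).
Definition kk_toY (h : subg_of (kk X Y)) : subg_of Y := subg Y (sgval h, 1%g).

Lemma kk_toXM x y : kk_toX (x * y)%g = (kk_toX y * kk_toX x)%g.
Proof.
rewrite /kk_toX -subgM; try by [rewrite kk_inX // groupV subgP].
by congr (subg X (_, _)); rewrite ?mulg1 //= invMg.
Qed.
Lemma kk_toYM : {morph kk_toY : x y / (x * y)%g}.
Proof.
move=> x y; rewrite /kk_toY -subgM; try by [rewrite kk_inY // subgP].
by congr (subg Y (_, _)); rewrite ?mulg1.
Qed.

(* m h = (1, h^-1) m and h n = (h, 1) n, see right_kk_elt and left_kk_elt. *)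
Definition right_kk (M : lmodType kX) : lmodType kA^c :=
  restr (galg_antimap kk_toXM : kA^c -> kX) M.
Definition left_kk (N : lmodType kY) : lmodType kA :=
  restr (galg_map kk_toYM : kA -> kY) N.

Lemma right_kk_elt (M : lmodType kX) h (m : right_kk M) :
  (gelt k h : kA^c) *: m = gelt k (kk_toX h) *: (m : M).
Proof. by rewrite restrZ /= /galg_antimap glin_elt. Qed.
Lemma left_kk_elt (N : lmodType kY) h (n : left_kk N) :
  gelt k h *: n = gelt k (kk_toY h) *: (n : N).
Proof. by rewrite restrZ /= /galg_map glin_elt. Qed.

Let glin_scal (aT bT : finGroupType) (f : aT -> bT) c :
  f 1%g = 1%g -> glin f (gscal (k := k) aT c) = gscal bT c.
Proof. by move=> f1; rewrite /gscal glinZ -gelt1 glin_elt f1. Qed.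

Lemma right_kk_scal (M : lmodType kX) c (m : right_kk M) :
  (gscal _ c : kA^c) *: m = gscal _ c *: (m : M).
Proof.
rewrite restrZ /= /galg_antimap glin_scal //; apply: (mulgI (kk_toX 1%g)).
by rewrite -kk_toXM !mulg1.
Qed.
Lemma left_kk_scal (N : lmodType kY) c (n : left_kk N) :
  gscal _ c *: n = gscal _ c *: (n : N).
Proof.
rewrite restrZ /= /galg_map glin_scal //; apply: (mulgI (kk_toY 1%g)).
by rewrite -kk_toYM !mulg1.
Qed.

(* Some h with (g, h) in X and (h, l) in Y; ext_opE shows that the action of
   (g, l) does not depend on the choice. *)
Definition middle (p : gT * lT) : hT :=
  odflt 1%g [pick h | ((p.1, h) \in X) && ((h, p.2) \in Y)].

Lemma middleP p : p \in star X Y ->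
  (p.1, middle p) \in X /\ (middle p, p.2) \in Y.
Proof.
rewrite inE /middle => /existsP[h hP]; case: pickP => [h' /andP[]//|/(_ h)].
by rewrite hP.
Qed.

Section Object.
Variables (M : lmodType kX) (N : lmodType kY).

Let T : lmodType k := ktensor (@gscalC k _) (right_kk M) (left_kk N).

Let actX (p : gT * hT) (m : M) : right_kk M := gelt k (subg X p) *: m.
Let actY (p : hT * lT) (n : N) : left_kk N := gelt k (subg Y p) *: n.

Let beta g h l (m : right_kk M) (n : left_kk N) : T :=
  tens (actX (g, h) m) (actY (h, l) n).

Let beta_balanced g h l :
  (g, h) \in X -> (h, l) \in Y -> balanced (beta g h l).
Proof.
move=> ghX hlY; apply: balanced_galg => [m m' n|m n n'|m c n|m x n]; rewrite /beta.
- by rewrite /actX scalerDr tensDl.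
- by rewrite /actY scalerDr tensDr.
- rewrite right_kk_scal left_kk_scal /actX /actY !scalerA -!gscalC -!scalerA.
  by rewrite -right_kk_scal -left_kk_scal tensZ.
set c := (h * sgval x * h^-1)%g.
have cK : c \in kk X Y.
  rewrite !inE; apply/andP; split.
    suff -> : (1%g, c) = ((g, h) * (1%g, sgval x) * (g, h)^-1)%g :> gT * hT.
      by rewrite !(groupM, groupV) // kk_inX ?subgP.
    by congr (_, _); rewrite /= mulg1 mulgV.
  suff -> : (c, 1%g) = ((h, l) * (sgval x, 1%g) * (h, l)^-1)%g :> hT * lT.
    by rewrite !(groupM, groupV) // kk_inY ?subgP.
  by congr (_, _); rewrite /= mulg1 mulgV.
pose c' : subg_of (kk X Y) := subg (kk X Y) c.
have cE : sgval c' = c by rewrite subgK.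
have cX : (subg X (g, h) * kk_toX x = kk_toX c' * subg X (g, h))%g.
  rewrite /kk_toX -!subgM //; try by rewrite kk_inX // groupV subgP.
  by congr (subg X (_, _)); rewrite ?mulg1 ?mul1g //= cE /c !invMg invgK mulgA mulgKV.
have cY : (kk_toY c' * subg Y (h, l) = subg Y (h, l) * kk_toY x)%g.
  rewrite /kk_toY -!subgM //; try by rewrite kk_inY // subgP.
  by congr (subg Y (_, _)); rewrite ?mulg1 ?mul1g //= cE mulgKV.
rewrite right_kk_elt left_kk_elt /actX /actY !scalerA -!geltM cX -cY !geltM.
by rewrite -!scalerA -right_kk_elt -left_kk_elt tensZ.
Qed.

Let gamma (z : subg_of (star_group X Y)) :=
  beta (sgval z).1 (middle (sgval z)) (sgval z).2.

Let gamma_balanced z : balanced (gamma z).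
Proof.
by have [zX zY] := middleP (subgP z); apply: beta_balanced.
Qed.

Definition ext_op (z : subg_of (star_group X Y)) : T -> T :=
  tlift (gamma_balanced z).

Lemma ext_opE g h l (m : M) (n : N) (ghX : (g, h) \in X) (hlY : (h, l) \in Y) :
  ext_op (subg (star X Y) (g, l)) (tens (m : right_kk M) (n : left_kk N))
  = tens (gelt k (subg X (g, h)) *: m : right_kk M)
         (gelt k (subg Y (h, l)) *: n : left_kk N).
Proof.
have gl : (g, l) \in star X Y by rewrite inE; apply/existsP; exists h; apply/andP.
rewrite /ext_op tliftE /gamma /beta subgK //=.
have [/= ghX' hlY'] := middleP gl; set h' := middle _ in ghX' hlY' *.
set c := (h^-1 * h')%g.
have cK : c \in kk X Y.
  rewrite !inE; apply/andP; split.
    suff -> : (1%g, c) = ((g, h)^-1 * (g, h'))%g :> gT * hT.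
      by rewrite groupM ?groupV.
    by congr (_, _); rewrite /= mulVg.
  suff -> : (c, 1%g) = ((h, l)^-1 * (h', l))%g :> hT * lT.
    by rewrite groupM ?groupV.
  by congr (_, _); rewrite /= mulVg.
pose c' : subg_of (kk X Y) := subg (kk X Y) c.
have cE : sgval c' = c by rewrite subgK.
have cX : (subg X (g, h') = subg X (g, h) * kk_toX c'^-1)%g.
  rewrite /kk_toX -subgM // ?kk_inX ?groupV ?subgP //.
  by congr (subg X (_, _)); rewrite ?mulg1 //= cE invgK mulKVg.
have cY : (subg Y (h', l) = subg Y (h, l) * kk_toY c')%g.
  rewrite /kk_toY -subgM // ?kk_inY ?subgP //.
  by congr (subg Y (_, _)); rewrite ?mulg1 //= cE mulKVg.
rewrite {1}/actX {1}/actY cX cY !geltM -!scalerA.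
have [_ _ bal] := beta_balanced ghX hlY.
rewrite -right_kk_elt -left_kk_elt.
have := bal m (gelt k c'^-1%g) (gelt k c' *: (n : left_kk N)).
by rewrite scalerA -geltM mulVg gelt1 scale1r.
Qed.

HB.instance Definition _ z := GRing.Additive.on (ext_op z).

Let starP (z : subg_of (star_group X Y)) : exists g h l,
  [/\ (g, h) \in X, (h, l) \in Y & z = subg (star X Y) (g, l)].
Proof.
have := subgP z; rewrite inE => /existsP[h /andP[zX zY]].
exists (sgval z).1, h, (sgval z).2; split=> //.
by rewrite -surjective_pairing sgvalK.
Qed.

Lemma ext_op_is_scalable z : scalable (ext_op z).
Proof.
apply: ktensor_scalable => c m n /=.
have [g [h [l [ghX hlY ->]]]] := starP z.
rewrite right_kk_scal !(ext_opE _ _ ghX hlY) ktensorZ right_kk_scal !scalerA.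
by rewrite gscalC.
Qed.
HB.instance Definition _ z :=
  GRing.isScalable.Build k T T *:%R (ext_op z) (ext_op_is_scalable z).

Lemma ext_op1 : ext_op 1%g =1 id.
Proof.
apply: (@ktensor_ext _ _ _ _ _ _ _ (ext_op 1%g) idfun) => m n /=.
rewrite -(morph1 (subg (star X Y))).
rewrite (ext_opE m n (group1 X) (group1 Y)) !(morph1 (subg _)) !gelt1.
by rewrite !scale1r.
Qed.

Lemma ext_opM y z : ext_op (y * z)%g =1 ext_op y \o ext_op z.
Proof.
apply: (ktensor_ext (f := ext_op (y * z)%g) (g := ext_op y \o ext_op z)).
move=> m n /=.
have [g [h [l [ghX hlY ->]]]] := starP y.
have [g' [h' [l' [ghX' hlY' ->]]]] := starP z.
rewrite -subgM; first last.
- by rewrite inE; apply/existsP; exists h'; apply/andP.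
- by rewrite inE; apply/existsP; exists h; apply/andP.
rewrite (ext_opE m n ghX' hlY') (ext_opE _ _ ghX hlY).
rewrite (ext_opE m n (groupM ghX ghX') (groupM hlY hlY')).
rewrite -[subg Y _]/(subg Y ((h, l) * (h', l'))%g).
by rewrite !subgM // !geltM !scalerA.
Qed.

Definition ext_rep : linrep k (subg_of (star_group X Y)) :=
  @LinRep k _ T ext_op ext_op1 ext_opM.
End Object.

Section Morphism.
Variables (M M' : lmodType kX) (N N' : lmodType kY).
Variables (f : {linear M -> M'}) (g : {linear N -> N'}).

Let phi : {linear rep_space (ext_rep M N) -> rep_space (ext_rep M' N')} :=
  ktmap (restr_map f : {linear right_kk M -> right_kk M'})
        (restr_map g : {linear left_kk N -> left_kk N'}).

Let phiC z t :
  phi (rep_op (ext_rep M N) z t) = rep_op (ext_rep M' N') z (phi t).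
Proof.
apply: (ktensor_ext (f := phi \o rep_op (ext_rep M N) z)
                    (g := rep_op (ext_rep M' N') z \o phi)) => m n /=.
rewrite /ext_op !(tliftE, ktmapE) /= /restr_map.
by rewrite !linearZ.
Qed.

Definition ext_map :
    {linear rep_mod (ext_rep M N) -> rep_mod (ext_rep M' N')} :=
  rep_map phiC.

Lemma ext_mapE m n :
  ext_map (tens m n) = tens (f m : right_kk M') (g n : left_kk N').
Proof. exact: ktmapE. Qed.
End Morphism.

Local Notation C := (prod_cat (mod_cat kX) (mod_cat kY)).
Local Notation D := (mod_cat (galg k (subg_of (star_group X Y)))).

Let ext_obj (p : C) : D := rep_mod (ext_rep p.1 p.2).
Let ext_mor (p q : C) (f : chom p q) : chom (ext_obj p) (ext_obj q) :=
  ext_map f.1 f.2.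

Let ext_mor_id p : ext_mor (idm p) = idm (ext_obj p).
Proof.
by apply/linear_ext/tensor_ext => m n; rewrite [LHS]ext_mapE.
Qed.

Let ext_mor_comp p q r (g : chom q r) (f : chom p q) :
  ext_mor (ccomp g f) = ccomp (ext_mor g) (ext_mor f).
Proof.
apply/linear_ext/tensor_ext => m n; rewrite [LHS]ext_mapE; symmetry.
exact: etrans (congr1 (ext_mor g) (ext_mapE f.1 f.2 m n))
              (ext_mapE g.1 g.2 (f.1 m) (f.2 n)).
Qed.

Definition ext_functor : functor C D := Functor ext_mor_id ext_mor_comp.

End ExtTensor.

Section DefRes.
Variables (gT hT lT : finGroupType).
Variables (X : {group gT * hT}) (Y : {group hT * lT}).
Local Notation F := (subg_of (fibprod_group X Y)).
Local Notation S := (subg_of (star_group X Y)).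

Definition nu (p : F) : S :=
  subg (star X Y) ((sgval (sgval p).1).1, (sgval (sgval p).2).2).

Let nu_in (p : F) :
  ((sgval (sgval p).1).1, (sgval (sgval p).2).2) \in star X Y.
Proof.
rewrite inE; apply/existsP; exists (sgval (sgval p).1).2 => /=.
have := subgP p; rewrite inE => /eqP {2}->.
by rewrite -!surjective_pairing !subgP.
Qed.

Lemma nuM : {in [set: F] &, {morph nu : x y / (x * y)%g}}.
Proof. by move=> x y _ _; rewrite /nu -subgM ?nu_in. Qed.
Canonical nu_morphism := Morphism nuM.

Lemma nu_surj (z : S) : exists p, nu p = z.
Proof.
have := subgP z; rewrite inE => /existsP[h /andP[zX zY]].
have EX : sgval (subg X ((sgval z).1, h)) = ((sgval z).1, h) by rewrite subgK.
have EY : sgval (subg Y (h, (sgval z).2)) = (h, (sgval z).2) by rewrite subgK.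
set p := (subg X ((sgval z).1, h), subg Y (h, (sgval z).2)).
have pF : p \in fibprod X Y by rewrite inE /= EX EY.
have Ep : sgval (subg (fibprod X Y) p) = p by rewrite subgK.
exists (subg (fibprod X Y) p).
by rewrite /nu Ep /= EX EY /= -surjective_pairing sgvalK.
Qed.

Lemma ker_nu_normal : ('ker nu <| [set: F])%g.
Proof. exact: ker_normal. Qed.

Definition nubar (c : coset_of ('ker nu)) : S := nu (repr c).

Lemma nubarE p : nubar (coset ('ker nu) p) = nu p.
Proof.
have pN : p \in 'N('ker nu)%g by apply: (subsetP (normal_norm ker_nu_normal)).
rewrite /nubar val_coset //.
case: repr_rcosetP => x /(@mker _ _ _ nu_morphism) /= nux.
by rewrite nuM // nux mul1g.
Qed.

Lemma nubarM : {in [set: coset_of ('ker nu)] &, {morph nubar : x y / (x * y)%g}}.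
Proof.
move=> x y _ _; have [p _ ->] := cosetP x; have [q _ ->] := cosetP y.
have N r : r \in 'N('ker nu)%g by apply: (subsetP (normal_norm ker_nu_normal)).
by rewrite -morphM // !nubarE nuM.
Qed.
Canonical nubar_morphism := Morphism nubarM.

Lemma nubar_bij : bijective nubar.
Proof.
have nubar_inj : injective nubar.
  move=> x y; have [p pN ->] := cosetP x; have [q qN ->] := cosetP y.
  rewrite !nubarE => pq; apply/rcoset_kercosetP => //.
  rewrite mem_rcoset; apply/(@kerP _ _ _ nu_morphism); rewrite ?inE //=.
  by rewrite nuM ?inE // (morphV nu_morphism) ?inE //= pq mulgV.
have nubar_surj z : exists c, nubar c == z.
  by have [p <-] := nu_surj z; exists (coset _ p); rewrite nubarE.
have nubarK : cancel (fun z => xchoose (nubar_surj z)) nubar.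
  by move=> z; apply/eqP/(xchooseP (nubar_surj z)).
exists (fun z => xchoose (nubar_surj z)) => // c.
exact/nubar_inj/nubarK.
Qed.

Definition DefRes : biset S (subg_of X * subg_of Y)%type :=
  biset_tensor (biset_tensor (iso_biset nubar_bij) (def_biset ker_nu_normal))
    (res_biset (fibprod_group X Y)).
End DefRes.

Definition defres_functor (k : comPzRingType) (gT hT lT : finGroupType)
    (X : {group gT * hT}) (Y : {group hT * lT}) :=
  functor_comp (biset_functor k (DefRes X Y))
               (outer_functor k (subg_of X) (subg_of Y)).

(* Main.v *)
Require Import Defs.
From HB Require Import structures.
From mathcomp Require Import all_boot all_order all_algebra all_fingroup.

Set Implicit Arguments.
Unset Strict Implicit.
Unset Printing Implicit Defensive.

(** Write D for the biset DefRes and F for the fibre product of X and Y over H.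
    D is generated by the single element e = (1 (x) 1) (x) 1: every element of
    D is e b for some b in X x Y ([defres_gen_trans]), the left action is given
    by nu(p) e = e p for p in F ([defres_gen_nu]), and e b = e b' holds only if
    b' = p b for some p in ker(nu) ([defres_gen_stab]).  In other words D is
    the quotient ker(nu)\(X x Y), so that D . T is the module of coinvariants
    of T under ker(nu), for every module T over X x Y.

    On the other side, ker(nu) consists of the elements ((1,h),(h,1)) with h in
    k(X,Y) ([ker_nuP], [kk_fibelt]).  Such an element sends (m h) (x) n to
    m (x) (h n), so passing from the tensor product of M and N over k to the one
    over k k(X,Y) is also the passage to the coinvariants of ker(nu).

    Accordingly the natural isomorphism is m (x) n |-> e (x) (m (x) n)
    ([ext_to_biset]).  Its inverse sends u (x) t to the class of b t, where b is
    any element with u = e b ([biset_to_ext]); the class is independent of b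
    because ker(nu) acts trivially on classes ([outer_quot_nu1]).  Since all
    modules involved are spanned by elementary tensors, equivariance, naturality
    and the two cancellation identities are checked on those.  The argument only
    uses the three properties of e listed above, and is carried out for an
    arbitrary biset U with an element e satisfying them
    ([ext_functor_biset]). *)

Import GRing.Theory.
Local Open Scope ring_scope.

(** * A generator of DefRes *)

Lemma btens_shift (gT hT lT : finGroupType) (U : biset gT hT) (V : biset hT lT)
    (h : hT) (u u' : U) (v v' : V) :
  br u h = u' -> bl h v = v' -> btens u' v = btens u v'.
Proof. by move=> <- <-; apply/btens_eqP; exists h; rewrite -brM mulgV br1. Qed.

Section DefResGenerator.
Variables (gT hT lT : finGroupType).
Variables (X : {group gT * hT}) (Y : {group hT * lT}).
Local Notation F := (subg_of (fibprod_group X Y)).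
Local Notation S := (subg_of (star_group X Y)).
Local Notation IsoDef :=
  (biset_tensor (iso_biset (nubar_bij X Y)) (def_biset (ker_nu_normal X Y))).

(** The generator 1 (x) 1 of Iso (x) Def, the first two factors of DefRes. *)
Definition isodef_gen : IsoDef :=
  btens (1%g : iso_biset (nubar_bij X Y)) (1%g : def_biset (ker_nu_normal X Y)).

(** The generator e = (1 (x) 1) (x) 1 of DefRes. *)
Definition defres_gen : DefRes X Y :=
  btens isodef_gen (1%g : res_biset (fibprod_group X Y)).

Lemma coset_nuM (p q : F) :
  coset ('ker (@nu _ _ _ X Y)) (p * q)
  = (coset ('ker (@nu _ _ _ X Y)) p * coset ('ker (@nu _ _ _ X Y)) q)%g.
Proof.
by rewrite morphM //; apply: (subsetP (normal_norm (ker_nu_normal X Y))).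
Qed.

Lemma isodef_gen_nu (p : F) : bl (nu p) isodef_gen = br isodef_gen p.
Proof.
rewrite /isodef_gen biset_tensor_lE biset_tensor_rE.
apply: (btens_shift (h := coset ('ker (@nu _ _ _ X Y)) p)).
  by rewrite /= mulg1 mul1g nubarE.
by rewrite /= mulg1 mul1g.
Qed.

(** The right action on Iso (x) Def is transitive: s (x) c equals (1 (x) 1)(qp)
    for any q above s and p above c. *)
Lemma isodef_gen_trans (v : IsoDef) : exists p, v = br isodef_gen p.
Proof.
have [s [c ->]] := btens_surj v.
have [q <-] := nu_surj s; have [p _ ->] := cosetP c.
exists (q * p)%g; rewrite biset_tensor_rE.
apply: (btens_shift (h := coset ('ker (@nu _ _ _ X Y)) q)).
  by rewrite /= mul1g nubarE.
by rewrite /= mul1g coset_nuM.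
Qed.

Lemma isodef_gen_stab (p : F) : br isodef_gen p = isodef_gen -> nu p = 1%g.
Proof.
rewrite biset_tensor_rE => /esym/btens_eqP[c [/= c1]].
rewrite mulg1 mul1g => /(congr1 (@nubar _ _ _ X Y)); rewrite nubarE => ->.
have /eqP : (1 * nubar c^-1)%g = 1%g := esym c1.
by rewrite mul1g (morphV (nubar_morphism X Y)) ?inE // invg_eq1 => /eqP.
Qed.

(** The left action on e is the right action of F, transported along nu; as nu
    is onto, it determines the left action on the whole of DefRes. *)
Lemma defres_gen_nu (p : F) : bl (nu p) defres_gen = br defres_gen (sgval p).
Proof.
rewrite /defres_gen biset_tensor_lE biset_tensor_rE isodef_gen_nu.
apply: (btens_shift (h := p)); first reflexivity.
by transitivity (sgval p); [apply: mulg1 | symmetry; apply: mul1g].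
Qed.

(** The right action on DefRes is transitive. *)
Lemma defres_gen_trans (u : DefRes X Y) : exists b, br defres_gen b == u.
Proof.
have [v [b ->]] := btens_surj u; have [p ->] := isodef_gen_trans v.
exists (sgval p * b)%g; apply/eqP; rewrite biset_tensor_rE; symmetry.
apply: (btens_shift (h := p)); [reflexivity | exact/esym/mul1g].
Qed.

(** The right stabiliser of e lies in ker(nu). *)
Lemma defres_gen_stab (b b' : subg_of X * subg_of Y) :
  br defres_gen b = br defres_gen b' ->
  exists2 p : F, nu p = 1%g & b' = (sgval p * b)%g.
Proof.
rewrite !biset_tensor_rE => /btens_eqP[p [/esym/isodef_gen_stab nup]] /=.
rewrite !mul1g => ->; exists p => //; apply/eqP.
by rewrite -invg_eq1 -(morphV (nu_morphism X Y)) ?inE //= nup.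
Qed.
End DefResGenerator.

(** * The fibre product and the kernel of nu *)

Section FibreProduct.
Variables (gT hT lT : finGroupType).
Variables (X : {group gT * hT}) (Y : {group hT * lT}).
Local Notation F := (subg_of (fibprod_group X Y)).

(** The element ((g,h),(h,l)) of the fibre product; meaningful when (g,h) is in
    X and (h,l) in Y, since [subg] returns 1 outside of its group. *)
Definition fibelt g h l : F :=
  subg (fibprod X Y) (subg X (g, h), subg Y (h, l)).

Lemma fibelt_val g h l : (g, h) \in X -> (h, l) \in Y ->
  sgval (fibelt g h l) = (subg X (g, h), subg Y (h, l)).
Proof. by move=> ghX hlY; rewrite /fibelt subgK // inE /= !subgK. Qed.

Lemma nu_fibelt g h l : (g, h) \in X -> (h, l) \in Y ->
  nu (fibelt g h l) = subg (star X Y) (g, l).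
Proof. by move=> ghX hlY; rewrite /nu fibelt_val //= !subgK. Qed.

Lemma star_in g h l : (g, h) \in X -> (h, l) \in Y -> (g, l) \in star X Y.
Proof. by move=> ghX hlY; rewrite inE; apply/existsP; exists h; apply/andP. Qed.

Lemma fibeltP (p : F) :
  exists g h l, [/\ (g, h) \in X, (h, l) \in Y & p = fibelt g h l].
Proof.
have := subgP p; rewrite inE => /eqP pE.
have [[g h] /= ghX gh] : exists2 x, x \in X & x = sgval (sgval p).1.
  by exists (sgval (sgval p).1) => //; apply: subgP.
have [[h' l] /= hlY hl] : exists2 y, y \in Y & y = sgval (sgval p).2.
  by exists (sgval (sgval p).2) => //; apply: subgP.
rewrite -gh -hl /= in pE; rewrite -{}pE in hlY hl.
exists g, h, l; split=> //; rewrite /fibelt gh hl !sgvalK.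
by rewrite -surjective_pairing sgvalK.
Qed.

(** [kk_toX h] is (1,h^-1): its inverse is the X-component of the kernel
    element attached to h. *)
Lemma kk_toXV (h : subg_of (kk X Y)) :
  (kk_toX h)^-1%g = subg X (1%g, sgval h).
Proof.
have hX : (1%g, sgval h) \in X by rewrite (@kk_inX _ _ _ X Y) ?subgP.
have hVX : (1%g, (sgval h)^-1%g) \in X.
  by rewrite (@kk_inX _ _ _ X Y) ?groupV ?subgP.
apply: (mulgI (kk_toX h)); rewrite mulgV /kk_toX -subgM //.
rewrite -(morph1 (subg X)).
by congr (subg X (_, _)); rewrite ?mulg1 ?mulVg.
Qed.

(** ((1,h),(h,1)) lies in ker(nu) for every h in k(X,Y). *)
Lemma kk_fibelt (h : subg_of (kk X Y)) :
  nu (fibelt 1%g (sgval h) 1%g) = 1%g /\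
  sgval (fibelt 1%g (sgval h) 1%g) = ((kk_toX h)^-1%g, kk_toY h).
Proof.
have hX : (1%g, sgval h) \in X by rewrite (@kk_inX _ _ _ X Y) ?subgP.
have hY : (sgval h, 1%g) \in Y by rewrite (@kk_inY _ _ _ X Y) ?subgP.
by rewrite nu_fibelt // fibelt_val // kk_toXV (morph1 (subg (star X Y))).
Qed.

(** Conversely, every element of ker(nu) is of that form. *)
Lemma ker_nuP (p : F) :
  nu p = 1%g -> exists h : subg_of (kk X Y), p = fibelt 1%g (sgval h) 1%g.
Proof.
have [g [h [l [ghX hlY ->]]]] := fibeltP p.
rewrite nu_fibelt // => /(congr1 sgval); rewrite subgK ?(star_in ghX hlY) //.
case=> g1 l1; rewrite {g}g1 {l}l1 in ghX hlY *.
have hK : h \in kk X Y by rewrite !inE ghX hlY.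
by exists (subg (kk X Y) h); rewrite subgK.
Qed.
End FibreProduct.

(** * Tensor products with a biset *)

(** The tensors u (x) m with u in U generate the additive group kU (x) M. *)
Lemma biset_tensor_ext (k : comPzRingType) (gT hT : finGroupType)
    (U : biset gT hT) (M : lmodType (galg k hT)) (Z : zmodType)
    (f g : {additive tensor (biset_mod k U) M -> Z}) :
  (forall u m, f (tens (belt k u) m) = g (tens (belt k u) m)) -> f =1 g.
Proof.
move=> fg; apply: tensor_ext => phi m; rewrite [phi]bcoefE.
have tens_sum (F : U -> biset_mod k U) :
    tens (\sum_u F u) m = \sum_u tens (F u) m.
  apply: (big_morph (fun phi => tens phi m)) => [a b|]; first exact: tensDl.
  by apply: (addIr (tens 0 m)); rewrite -tensDl !add0r.
rewrite tens_sum !raddf_sum; apply: eq_bigr => u _.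
by rewrite tensZ fg.
Qed.

Lemma bcoef_scal (k : comPzRingType) (gT hT : finGroupType) (U : biset gT hT)
    c (phi : biset_mod k U) u :
  bcoef ((gscal hT c : (galg k hT)^c) *: phi) u = c * bcoef phi u.
Proof.
rewrite /bcoef ffunE (bigD1 1%g) //= big1 ?addr0 => [|h /negPf h1].
  by rewrite gcoefZ gcoef_elt eqxx mulr1 invg1 br1.
by rewrite gcoefZ gcoef_elt h1 mulr0 mul0r.
Qed.

Lemma bcoef_r (k : comPzRingType) (gT hT : finGroupType) (U : biset gT hT)
    h (phi : biset_mod k U) u :
  bcoef ((gelt k h : (galg k hT)^c) *: phi) u = bcoef phi (br u h^-1%g).
Proof.
rewrite {1}/bcoef ffunE (bigD1 h) //= big1 ?addr0 => [|x /negPf xh].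
  by rewrite gcoef_elt eqxx mul1r.
by rewrite gcoef_elt xh mul0r.
Qed.

Lemma gscal_scaleC (k : comPzRingType) (gT : finGroupType)
    (M : lmodType (galg k gT)) c a (m : M) :
  gscal gT c *: (a *: m) = a *: (gscal gT c *: m).
Proof. by rewrite !scalerA gscalC. Qed.

(** The case of [tensor_ext] for the external tensor product, with its module
    structure over the product group. *)
Lemma outer_ext (k : comPzRingType) (gT hT : finGroupType)
    (M : lmodType (galg k gT)) (N : lmodType (galg k hT)) (Z : zmodType)
    (f g : {additive rep_mod (outer_rep M N) -> Z}) :
  (forall m n, f (tens (m : restr (@gscalc k gT) M) (n : restr (@gscal k hT) N))
             = g (tens (m : restr (@gscalc k gT) M) (n : restr (@gscal k hT) N))) ->
  f =1 g.
Proof. exact: tensor_ext. Qed.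

(** A linear map with a set-theoretic inverse is an isomorphism of modules. *)
Lemma mod_cat_is_iso (R : pzRingType) (M N : lmodType R) (f : {linear M -> N})
    (g : N -> M) :
  cancel f g -> cancel g f -> is_iso (C := mod_cat R) (a := M) (b := N) f.
Proof.
move=> fK gK.
have gB : zmod_morphism g := can2_zmod_morphism fK gK.
have gZ : scalable g := can2_scalable fK gK.
pose gL : {linear N -> M} := HB.pack g
  (GRing.isZmodMorphism.Build N M g gB) (GRing.isScalable.Build R N M *:%R g gZ).
by exists gL; split; apply: linear_ext => x /=; rewrite ?fK ?gK.
Qed.

(** * The isomorphism attached to a generator *)

Section GeneratedBiset.
Variables (k : comPzRingType) (gT hT lT : finGroupType).
Variables (X : {group gT * hT}) (Y : {group hT * lT}).
Local Notation F := (subg_of (fibprod_group X Y)).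
Local Notation S := (subg_of (star_group X Y)).
Local Notation B := (subg_of X * subg_of Y)%type.
Local Notation kX := (galg k (subg_of X)).
Local Notation kY := (galg k (subg_of Y)).
(* The third hypothesis leaves open whether all of ker(nu) fixes e; this follows
   from the first one, see biset_tens_nu1. *)
Variables (U : biset S B) (e : U).
Hypothesis e_nu : forall p : F, bl (nu p) e = br e (sgval p).
Hypothesis e_trans : forall u, exists b, br e b == u.
Hypothesis e_stab : forall b b', br e b = br e b' ->
  exists2 p : F, nu p = 1%g & b' = (sgval p * b)%g.

Section Object.
Variables (M : lmodType kX) (N : lmodType kY).

(** m (x) n in the external tensor product over k. *)
Definition outer_tens (m : M) (n : N) : rep_mod (outer_rep M N) :=
  tens (m : restr (@gscalc k (subg_of X)) M) (n : restr (@gscal k (subg_of Y)) N).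

(** m (x) n in the extended tensor product, over the group algebra of k(X,Y). *)
Definition ext_tens (m : M) (n : N) : rep_mod (ext_rep M N) :=
  tens (m : right_kk Y M) (n : left_kk X N).

Lemma outer_tensZ x y (m : M) (n : N) :
  gelt k (x, y) *: outer_tens m n = outer_tens (gelt k x *: m) (gelt k y *: n).
Proof. by rewrite rep_mod_elt [LHS]outer_repE. Qed.

Lemma outer_tens_scal c (m : M) (n : N) :
  gscal _ c *: outer_tens m n = outer_tens (gscal _ c *: m) n.
Proof. by rewrite rep_mod_scal [LHS]ktensorZ. Qed.

Lemma outer_tens_scalr c (m : M) (n : N) :
  outer_tens (gscal _ c *: m) n = outer_tens m (gscal _ c *: n).
Proof. exact: tensZ. Qed.

Lemma ext_tensZ g h l (m : M) (n : N) : (g, h) \in X -> (h, l) \in Y ->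
  gelt k (subg (star X Y) (g, l)) *: ext_tens m n =
  ext_tens (gelt k (subg X (g, h)) *: m) (gelt k (subg Y (h, l)) *: n).
Proof. by move=> ghX hlY; rewrite rep_mod_elt [LHS](ext_opE m n ghX hlY). Qed.

Lemma ext_tens_kscal c (m : M) (n : N) :
  c *: (ext_tens m n : rep_space (ext_rep M N)) = ext_tens (gscal _ c *: m) n.
Proof. by rewrite [LHS]ktensorZ right_kk_scal. Qed.

Lemma ext_tens_scal c (m : M) (n : N) :
  gscal _ c *: ext_tens m n = ext_tens (gscal _ c *: m) n.
Proof. by rewrite rep_mod_scal ext_tens_kscal. Qed.

(** Balancedness over k(X,Y): (1,h^-1) m (x) n = m (x) (h,1) n. *)
Lemma ext_tens_kk x (m : M) (n : N) :
  ext_tens (gelt k (kk_toX x) *: m) n = ext_tens m (gelt k (kk_toY x) *: n).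
Proof.
by rewrite /ext_tens -[X in tens X _](right_kk_elt x) -[in RHS]left_kk_elt tensZ.
Qed.

Lemma ext_tens_scalr c (m : M) (n : N) :
  ext_tens (gscal _ c *: m) n = ext_tens m (gscal _ c *: n).
Proof.
by rewrite /ext_tens -[X in tens X _]right_kk_scal -[in RHS]left_kk_scal tensZ.
Qed.

Lemma ext_tens_balanced :
  balanced (fun (m : restr (@gscalc k (subg_of X)) M)
                (n : restr (@gscal k (subg_of Y)) N) => ext_tens m n).
Proof.
split=> [m m' n|m n n'|m c n]; [exact: tensDl | exact: tensDr |].
exact: ext_tens_scalr.
Qed.

(** The quotient map from the tensor product over k to the extended tensor
    product, m (x) n |-> m (x) n. *)
Definition outer_quot : rep_mod (outer_rep M N) -> rep_mod (ext_rep M N) :=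
  tlift ext_tens_balanced.
HB.instance Definition _ := GRing.isZmodMorphism.Build
  (rep_mod (outer_rep M N)) (rep_mod (ext_rep M N)) outer_quot
  (tlift_is_zmod_morphism ext_tens_balanced).

Lemma outer_quotE m n : outer_quot (outer_tens m n) = ext_tens m n.
Proof. exact: tliftE. Qed.

Lemma outer_quot_scal c t : outer_quot (gscal _ c *: t) = gscal _ c *: outer_quot t.
Proof.
apply: (outer_ext (f := outer_quot \o *:%R (gscal _ c))
                  (g := *:%R (gscal _ c) \o outer_quot)) => m n /=.
by rewrite -/(outer_tens m n) outer_tens_scal !outer_quotE ext_tens_scal.
Qed.

Lemma outer_quot_gscal c a t :
  outer_quot (a *: (gscal _ c *: t)) = gscal _ c *: outer_quot (a *: t).
Proof.
rewrite -outer_quot_scal; apply: (congr1 outer_quot).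
exact/esym/gscal_scaleC.
Qed.

(** The kernel of nu acts trivially on classes. *)
Lemma outer_quot_nu1 (p : F) t :
  nu p = 1%g -> outer_quot (gelt k (sgval p) *: t) = outer_quot t.
Proof.
case/ker_nuP=> h ->; have [_ ->] := kk_fibelt h.
apply: (outer_ext (f := outer_quot \o *:%R (gelt k _)) (g := outer_quot)) => m n.
rewrite -/(outer_tens m n) /= outer_tensZ !outer_quotE -ext_tens_kk scalerA -geltM.
by rewrite mulgV gelt1 scale1r.
Qed.

(** A chosen b with e b = u. *)
Definition gen_coord (u : U) : B := xchoose (e_trans u).

(** The class of b t depends only on u = e b, and not on b. *)
Lemma outer_quot_gen u b t :
  br e b = u ->
  outer_quot (gelt k (gen_coord u) *: t) = outer_quot (gelt k b *: t).
Proof.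
have := xchooseP (e_trans u); rewrite -/(gen_coord u).
(* The chosen coordinate is generalised before u is replaced, as it depends
   on u itself. *)
move: (gen_coord u) => b' /eqP <- /esym/e_stab[p nup ->].
have -> : gelt k (sgval p * b')%g *: t = gelt k (sgval p) *: (gelt k b' *: t).
  by rewrite scalerA -geltM.
exact/esym/outer_quot_nu1.
Qed.

Lemma outer_quot_gen_r u x t :
  outer_quot (gelt k (gen_coord (br u x)) *: t)
  = outer_quot (gelt k (gen_coord u) *: (gelt k x *: t)).
Proof.
have /eqP ue := xchooseP (e_trans u).
have -> : gelt k (gen_coord u) *: (gelt k x *: t)
          = gelt k (gen_coord u * x)%g *: t by rewrite scalerA -geltM.
by apply: outer_quot_gen; rewrite brM [br e _]ue.
Qed.

(** The k-linear extension in u of (u, t) |-> class of b t, where u = e b. *)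
Definition biset_to_ext_fun (phi : biset_mod k U) (t : rep_mod (outer_rep M N)) :
    rep_mod (ext_rep M N) :=
  \sum_u gscal _ (bcoef phi u) *: outer_quot (gelt k (gen_coord u) *: t).

Lemma biset_to_ext_balanced : balanced biset_to_ext_fun.
Proof.
apply: balanced_galg => [phi psi t|phi t t'|phi c t|phi x t];
  rewrite /biset_to_ext_fun.
- rewrite -big_split; apply: eq_bigr => u _.
  by rewrite /bcoef ffunE raddfD scalerDl.
- rewrite -big_split; apply: eq_bigr => u _ /=.
  by rewrite scalerDr [outer_quot _]raddfD scalerDr.
- apply: eq_bigr => u _; rewrite bcoef_scal mulrC rmorphM -scalerA.
  by apply: (congr1 ( *:%R _)); rewrite outer_quot_gscal.
(* For a group element x, the sum is reindexed along u |-> u x. *)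
have brK y : cancel (fun u : U => br u y) (fun u => br u y^-1%g).
  by move=> u; rewrite -brM mulgV br1.
rewrite (reindex_inj (can_inj (brK x))); apply: eq_bigr => u _ /=.
by rewrite bcoef_r brK outer_quot_gen_r.
Qed.

(** The inverse map kU (x) T -> extended tensor product, for T the external
    tensor product.  It is only recorded as an additive map; its linearity
    follows from its being the inverse of a linear map. *)
Definition biset_to_ext :
    rep_mod (biset_rep U (rep_mod (outer_rep M N))) -> rep_mod (ext_rep M N) :=
  tlift biset_to_ext_balanced.
HB.instance Definition _ := GRing.isZmodMorphism.Build
  (rep_mod (biset_rep U (rep_mod (outer_rep M N)))) (rep_mod (ext_rep M N))
  biset_to_ext (tlift_is_zmod_morphism biset_to_ext_balanced).

(** u (x) t in U . T, for T the external tensor product. *)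
Definition biset_tens (u : U) (t : rep_mod (outer_rep M N)) :
    rep_mod (biset_rep U (rep_mod (outer_rep M N))) :=
  tens (belt k u) t.

Lemma biset_tens_is_zmod_morphism u : zmod_morphism (biset_tens u).
Proof.
move=> s t; apply: (addIr (biset_tens u t)).
by rewrite -[LHS]tensDr !subrK.
Qed.
HB.instance Definition _ u := GRing.isZmodMorphism.Build
  (rep_mod (outer_rep M N)) (rep_mod (biset_rep U (rep_mod (outer_rep M N))))
  (biset_tens u) (biset_tens_is_zmod_morphism u).

Lemma biset_to_extE b t :
  biset_to_ext (biset_tens (br e b) t) = outer_quot (gelt k b *: t).
Proof.
rewrite [LHS]tliftE /biset_to_ext_fun (bigD1 (br e b)) //=.
rewrite big1 ?addr0 => [|u /negPf ub].
  by rewrite /bcoef ffunE eqxx rmorph1 scale1r; apply: outer_quot_gen.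
by rewrite /bcoef ffunE ub rmorph0 scale0r.
Qed.

Lemma biset_tensZl x u t :
  gelt k x *: biset_tens u t = biset_tens (bl x u) t.
Proof.
rewrite rep_mod_elt [LHS]ktmapE.
exact: (congr1 (fun phi => tens phi t) (belt_l k x u)).
Qed.

Lemma biset_tensZr b u t :
  biset_tens (br u b) t = biset_tens u (gelt k b *: t).
Proof. by rewrite /biset_tens -belt_r tensZ. Qed.

Lemma biset_tens_kscal c u t :
  c *: (biset_tens u t : rep_space (biset_rep U (rep_mod (outer_rep M N))))
  = biset_tens u (gscal _ c *: t).
Proof. by rewrite [LHS]ktensorZ tensZ. Qed.

Lemma biset_tens_nu1 (p : F) t :
  nu p = 1%g -> biset_tens e (gelt k (sgval p) *: t) = biset_tens e t.
Proof. by move=> nup; rewrite -biset_tensZr -e_nu nup bl1. Qed.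

(** The map (m, n) |-> e (x) (m (x) n) is balanced over k(X,Y): p = ((1,h),(h,1))
    fixes e and sends (1,h^-1) m (x) n to m (x) (h,1) n. *)
Lemma ext_to_biset_balanced :
  balanced (fun (m : right_kk Y M) (n : left_kk X N) => biset_tens e (outer_tens m n)).
Proof.
apply: balanced_galg => [m m' n|m n n'|m c n|m h n].
- by rewrite [outer_tens _ _]tensDl [LHS]tensDr.
- by rewrite [outer_tens _ _]tensDr [LHS]tensDr.
- by rewrite right_kk_scal left_kk_scal outer_tens_scalr.
have [nup pE] := kk_fibelt h.
rewrite right_kk_elt left_kk_elt -(biset_tens_nu1 _ nup) pE outer_tensZ.
by rewrite scalerA -geltM mulVg gelt1 scale1r.
Qed.

(** The map m (x) n |-> e (x) (m (x) n), between the underlying k-modules. *)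
Definition ext_to_biset_lin :
    rep_space (ext_rep M N) ->
    rep_space (biset_rep U (rep_mod (outer_rep M N))) :=
  tlift ext_to_biset_balanced.
HB.instance Definition _ := GRing.isZmodMorphism.Build
  (rep_space (ext_rep M N)) (rep_space (biset_rep U (rep_mod (outer_rep M N))))
  ext_to_biset_lin (tlift_is_zmod_morphism ext_to_biset_balanced).

Lemma ext_to_biset_linE m n :
  ext_to_biset_lin (ext_tens m n) = biset_tens e (outer_tens m n).
Proof. exact: tliftE. Qed.

Lemma ext_to_biset_lin_scalable : scalable ext_to_biset_lin.
Proof.
move=> c.
apply: (ktensor_ext (f := ext_to_biset_lin \o *:%R c)
                    (g := *:%R c \o ext_to_biset_lin)) => m n /=.
rewrite -/(ext_tens m n) ext_tens_kscal !ext_to_biset_linE.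
by rewrite biset_tens_kscal outer_tens_scal.
Qed.
HB.instance Definition _ := GRing.isScalable.Build k
  (rep_space (ext_rep M N)) (rep_space (biset_rep U (rep_mod (outer_rep M N))))
  *:%R ext_to_biset_lin ext_to_biset_lin_scalable.

(** Equivariance under X * Y: for p = ((g,h),(h,l)), the element nu(p) = (g,l)
    acts on e (x) t as e p (x) t = e (x) p t. *)
Lemma ext_to_biset_lin_op x t :
  ext_to_biset_lin (rep_op (ext_rep M N) x t) =
  rep_op (biset_rep U (rep_mod (outer_rep M N))) x (ext_to_biset_lin t).
Proof.
apply: (ktensor_ext (f := ext_to_biset_lin \o rep_op (ext_rep M N) x)
  (g := rep_op (biset_rep U (rep_mod (outer_rep M N))) x \o ext_to_biset_lin)) => m n /=.
rewrite -/(ext_tens m n) ext_to_biset_linE.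
apply: etrans (congr1 ext_to_biset_lin (esym (rep_mod_elt x (ext_tens m n)))) _.
apply: etrans (rep_mod_elt x (biset_tens e (outer_tens m n))).
rewrite biset_tensZl.
have [p <-] := nu_surj x; have [g [h [l [ghX hlY ->]]]] := fibeltP p.
rewrite e_nu fibelt_val // biset_tensZr outer_tensZ nu_fibelt //.
by rewrite (ext_tensZ _ _ ghX hlY) ext_to_biset_linE.
Qed.

(** The same map, as a morphism of modules over X * Y. *)
Definition ext_to_biset :
    {linear rep_mod (ext_rep M N) ->
            rep_mod (biset_rep U (rep_mod (outer_rep M N)))} :=
  rep_map ext_to_biset_lin_op.

Lemma ext_to_bisetE m n : ext_to_biset (ext_tens m n) = biset_tens e (outer_tens m n).
Proof. exact: ext_to_biset_linE. Qed.

Lemma ext_to_bisetK : cancel ext_to_biset biset_to_ext.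
Proof.
apply: (tensor_ext (f := biset_to_ext \o ext_to_biset) (g := idfun)) => m n /=.
rewrite -/(ext_tens m n) ext_to_bisetE -[e]br1 biset_to_extE.
by rewrite gelt1 scale1r outer_quotE.
Qed.

Lemma biset_to_extK : cancel biset_to_ext ext_to_biset.
Proof.
apply: (biset_tensor_ext (f := ext_to_biset \o biset_to_ext) (g := idfun)) => u t /=.
(* u = e b, and e b (x) t = e (x) b t: it suffices to treat u = e. *)
rewrite -/(biset_tens u t); have [b /eqP <-] := e_trans u.
rewrite biset_to_extE biset_tensZr; move: (gelt k b *: t) => {}t.
apply: (outer_ext (f := ext_to_biset \o outer_quot) (g := biset_tens e)) => m n /=.
by rewrite -/(outer_tens m n) outer_quotE ext_to_bisetE.
Qed.

End Object.

(** * Naturality *)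

Section Morphisms.
Variables (M M' : lmodType kX) (N N' : lmodType kY).

Lemma ext_tens_ext (Z : zmodType) (u v : {additive rep_mod (ext_rep M N) -> Z}) :
  (forall m n, u (ext_tens m n) = v (ext_tens m n)) -> u =1 v.
Proof. exact: (@tensor_ext _ (right_kk Y M) (left_kk X N) Z u v). Qed.

Variables (f : {linear M -> M'}) (g : {linear N -> N'}).

Lemma ext_map_tens m n : ext_map f g (ext_tens m n) = ext_tens (f m) (g n).
Proof. exact: ext_mapE. Qed.

Lemma outer_map_tens m n : outer_map f g (outer_tens m n) = outer_tens (f m) (g n).
Proof. exact: outer_mapE. Qed.

Lemma biset_map_tens (u : U) t :
  biset_map U (outer_map f g) (biset_tens u t) = biset_tens u (outer_map f g t).
Proof. exact: biset_mapE. Qed.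

Lemma ext_to_biset_natural_tens m n :
  ext_to_biset M' N' (ext_map f g (ext_tens m n))
  = biset_map U (outer_map f g) (ext_to_biset M N (ext_tens m n)).
Proof.
by rewrite ext_map_tens !ext_to_bisetE biset_map_tens outer_map_tens.
Qed.

Lemma ext_to_biset_natural :
  ext_to_biset M' N' \o ext_map f g
  =1 biset_map U (outer_map f g) \o ext_to_biset M N.
Proof. by apply: ext_tens_ext => m n; apply: ext_to_biset_natural_tens. Qed.
End Morphisms.

Local Notation biset_outer_functor :=
  (functor_comp (biset_functor k U) (outer_functor k (subg_of X) (subg_of Y))).
Local Notation C := (prod_cat (mod_cat kX) (mod_cat kY)).

(** [ext_to_biset] as a morphism of the category of modules over X * Y. *)
Definition ext_biset_mor (M : lmodType kX) (N : lmodType kY) :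
  @chom (mod_cat (galg k S)) (rep_mod (ext_rep M N))
    (rep_mod (biset_rep U (rep_mod (outer_rep M N)))) := ext_to_biset M N.

Lemma ext_biset_mor_natural (M M' : lmodType kX) (N N' : lmodType kY)
    (f : {linear M -> M'}) (g : {linear N -> N'}) :
  ccomp (ext_biset_mor M' N') (ext_map f g : @chom (mod_cat (galg k S)) _ _)
  = ccomp (biset_map U (outer_map f g) : @chom (mod_cat (galg k S)) _ _)
          (ext_biset_mor M N).
Proof.
exact/linear_ext/(ext_to_biset_natural f g).
Qed.

Lemma ext_biset_mor_iso (M : lmodType kX) (N : lmodType kY) : is_iso (ext_biset_mor M N).
Proof.
apply: (@mod_cat_is_iso (galg k S) _ _ (ext_biset_mor M N)
  (biset_to_ext (M := M) (N := N))).
  exact: ext_to_bisetK.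
exact: biset_to_extK.
Qed.

(** The family of the preceding morphisms, indexed by pairs (M, N). *)
Definition ext_biset_trans (p : C) :
  chom (ext_functor k X Y p) (biset_outer_functor p) :=
  ext_biset_mor p.1 p.2.

Lemma ext_biset_trans_natural : natural ext_biset_trans.
Proof.
move=> [M N] [M' N'] [f g]; exact: (ext_biset_mor_natural f g).
Qed.

Lemma ext_biset_trans_iso p : is_iso (ext_biset_trans p).
Proof. exact: ext_biset_mor_iso. Qed.

(** The extended tensor product is U . (M (x) N), for every biset U generated by
    an element with the three properties of the generator of DefRes. *)
Lemma ext_functor_biset :
  naturally_isomorphic (ext_functor k X Y) biset_outer_functor.
Proof.
by exists ext_biset_trans;
  [exact: ext_biset_trans_natural | exact: ext_biset_trans_iso].
Qed.
End GeneratedBiset.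

Theorem proposition3p4 (k : comPzRingType) (gT hT kT : finGroupType)
    (X : {group gT * hT}) (Y : {group hT * kT}) :
  naturally_isomorphic (ext_functor k X Y) (defres_functor k X Y).
Proof.
apply: (ext_functor_biset k (e := defres_gen X Y)).
- exact: defres_gen_nu.
- exact: defres_gen_trans.
- exact: defres_gen_stab.
Qed.
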